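(* Let $\mathcal H$ be a hypergraph on a finite set $V$. The map $S\mapsto\widehat S$ is an inclusion-order isomorphism from $\operatorname{Stop}(\mathcal H)$ onto $\operatorname{Stop}(\operatorname{Split}(\mathcal H))$. Its inverse sends a stopping set $T$ to $\{v\in V: t_v\in T\}$. The map preserves the empty set and hence restricts to a bijection between the minimal nonempty stopping sets. Under complementation, the induced bijection between coatom families sends a coatom $M$ of $\operatorname{Mod}(\Phi_{\mathcal H})$ to the coatom $$V(\operatorname{Split}(\mathcal H))\setminus\widehat{\,V\setminus M\,}$$ of $\operatorname{Mod}(\Phi_{\operatorname{Split}(\mathcal H)})$. Furthermore, $\Delta(\operatorname{Split}(\mathcal H))\le 3$ and $\operatorname{rank}(\operatorname{Split}(\mathcal H))\le\max\{2,\operatorname{rank}(\mathcal H)\}$. The split hypergraph has incidence length $O(L(\mathcal H))$ and can be constructed in $O(L(\mathcal H))$ time. The forward and inverse set maps are computable in time linear in their input and output encodings. If $\mathcal H$ is normalized, then $\operatorname{Split}(\mathcal H)$ is normalized. If every hyperedge of $\mathcal H$ has size two or three, then the same is true of every hyperedge of $\operatorname{Split}(\mathcal H)$.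
   Context: A hypergraph on a finite set $V=V(\mathcal H)$ is a family $\mathcal H\subseteq 2^V$, given by its incidence list; it is normalized if it has no repeated incidences, no duplicate hyperedges and no empty hyperedge. Put $L(\mathcal H)=|V|+|\mathcal H|+\sum_{A\in\mathcal H}|A|$ (the incidence length), $\operatorname{rank}(\mathcal H)=\max_{A\in\mathcal H}|A|$ and $\Delta(\mathcal H)=\max_{v\in V}|\{A\in\mathcal H: v\in A\}|$, with empty maxima equal to zero. A set $S\subseteq V$ is a stopping set of $\mathcal H$ if $|A\cap S|\ne1$ for every $A\in\mathcal H$; $\operatorname{Stop}(\mathcal H)$ is the family of stopping sets. The associated definite Horn CNF is $\Phi_{\mathcal H}=\bigwedge_{A\in\mathcal H}\bigwedge_{v\in A}((A\setminus\{v\})\to v)$, with model family $\operatorname{Mod}(\Phi_{\mathcal H})\subseteq 2^V$ (models identified with sets of true variables); a coatom is an inclusion-maximal member of $\operatorname{Mod}(\Phi_{\mathcal H})\setminus\{V\}$. Construction of $\operatorname{Split}(\mathcal H)$. For each incidence $v\in A\in\mathcal H$, introduce a distinct occurrence element $v_A$, and put $A^\circ=\{v_A: v\in A\}$ for every $A\in\mathcal H$. For each $v\in V$ let $\mathcal O_v=\{v_A: A\in\mathcal H, v\in A\}$, $d_v=|\mathcal O_v|$, and introduce one additional element $t_v$ (the terminal of $v$). Choose a tree $T_v$ as follows: if $d_v=0$, $T_v$ is the single vertex $t_v$; if $d_v=1$, $T_v$ is the single edge joining the unique occurrence element to $t_v$; if $d_v\ge2$, $T_v$ is a tree of maximum degree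 at most three whose leaves are exactly the elements of $\mathcal O_v\cup\{t_v\}$, whose internal vertices are fresh elements, and which has $O(d_v)$ vertices and edges (constructed in $O(d_v)$ time). All occurrence elements, terminals and internal vertices used for different $v$ are distinct. Let $B_v=V(T_v)$. Then $\operatorname{Split}(\mathcal H)$ is the hypergraph with ground set $\bigcup_{v\in V}B_v$ whose hyperedges are the sets $A^\circ$ for $A\in\mathcal H$ together with the two-element sets given by all edges of all trees $T_v$. For $S\subseteq V$, $\widehat S=\bigcup_{v\in S}B_v$. *)

(* Defs.v *)
From mathcomp Require Import all_boot.

Set Implicit Arguments.
Unset Strict Implicit.
Unset Printing Implicit Defensive.

(* A hypergraph is given by its incidence list, one entry per hyperedge; entry
   [A] stands for the set of its elements.  Nothing excludes repeated
   incidences, duplicate hyperedges or empty hyperedges.  For [A : seq V],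
   [#|A|] counts distinct elements whereas [size A] counts listed incidences. *)
Notation hypergraph V := (seq (seq V)).

Section Hypergraphs.
Variable V : finType.
Implicit Types (H : hypergraph V) (S M : {set V}).

Definition normalized H : Prop :=
  [/\ all uniq H, uniq [seq [set v in A] | A <- H] & [::] \notin H].

Definition incidence_length H : nat :=
  #|V| + size H + \sum_(A <- H) size A.

Definition rank H : nat := \max_(A <- H) #|A|.

Definition max_degree H : nat := \max_(v : V) count (fun A => v \in A) H.

Definition stopping H S : bool :=
  all (fun A : seq V => #|[set v in A] :&: S| != 1) H.

Definition Stop H : {set {set V}} := [set S | stopping H S].

Definition minimal_nonempty (F : {set {set V}}) : {set {set V}} :=
  [set S | minset [pred X : {set V} | (X \in F) && (X != set0)] S].

(* The definite Horn clause [B -> v] is the pair [(B, v)]. *)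
Definition horn_cnf H : seq ({set V} * V) :=
  [seq ([set u in A] :\ v, v) | A <- H, v <- A].

Definition models (phi : seq ({set V} * V)) : {set {set V}} :=
  [set M : {set V} |
     all (fun cl : {set V} * V => (cl.1 \subset M) ==> (cl.2 \in M)) phi].

Definition coatoms (F : {set {set V}}) : {set {set V}} :=
  [set M | maxset [pred X : {set V} | (X \in F) && (X != setT)] M].

End Hypergraphs.

Definition bij_between (aT rT : finType) (f : aT -> rT)
    (A : {set aT}) (B : {set rT}) : Prop :=
  {in A &, injective f} /\ f @: A = B.

Definition subset_iso (V W : finType) (f : {set V} -> {set W})
    (A : {set {set V}}) (B : {set {set W}}) : Prop :=
  bij_between f A B /\
  {in A &, forall S S' : {set V}, (f S \subset f S') = (S \subset S')}.

(* Finite graphs given by vertex and edge lists; the pair [(x, y)] is the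
   undirected edge {x, y}. *)
Record graph (W : finType) := Graph { nodes : seq W; edges : seq (W * W) }.

Section Graphs.
Variable W : finType.
Implicit Types (T : graph W) (x y : W).

Definition edge_sets T : seq {set W} :=
  [seq [set e.1; e.2] | e <- edges T].

Definition adj T : rel W := fun x y => [set x; y] \in edge_sets T.

Definition simple T : Prop :=
  [/\ uniq (nodes T), uniq (edge_sets T) &
      {in edges T, forall e,
         [/\ e.1 \in nodes T, e.2 \in nodes T & e.1 != e.2]}].

Definition connected T : Prop :=
  {in nodes T &, forall x y, connect (adj T) x y}.

Definition acyclic T : Prop :=
  forall c : seq W, ucycle (adj T) c -> size c <= 2.

Definition is_tree T : Prop :=
  [/\ simple T, nodes T != [::], connected T & acyclic T].

Definition degree T x : nat := #|[set y | adj T x y]|.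

Definition leaves T : {set W} := [set x in nodes T | degree T x == 1].

End Graphs.

(* The choices made in forming Split(H).  [W] is its ground set, [occ D v i] the
   occurrence element of the incidence of [v] in the [i]-th hyperedge (junk if
   there is no such incidence), [term D v] is t_v and [tree D v] is T_v. *)
Record splitting (V : finType) (H : hypergraph V) (W : finType) := Splitting {
  occ : V -> nat -> W;
  term : V -> W;
  tree : V -> graph W
}.

Section Splitting.
Variables (V : finType) (H : hypergraph V) (W : finType).
Implicit Types (D : splitting H W) (v : V).

Definition occs D v : {set W} :=
  [set occ D v i | i : 'I_(size H) & v \in nth [::] H i].

(* [c] is the constant in the requirement that T_v has O(d_v) vertices and
   edges. *)
Definition valid_tree (c : nat) D v : Prop :=
  let T := tree D v in
  let d := #|occs D v| in
  match d with
  | 0 => nodes T = [:: term D v] /\ edges T = [::]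
  | 1 => [/\ uniq (nodes T), nodes T =i term D v |: occs D v &
             edge_sets T = [:: term D v |: occs D v]]
  | _ => [/\ is_tree T, {in nodes T, forall x, degree T x <= 3},
             leaves T = term D v |: occs D v,
             size (nodes T) <= c * d & size (edges T) <= c * d]
  end.

Record valid_splitting (c : nat) D : Prop := ValidSplitting {
  occ_distinct : forall u v i j, i < size H -> j < size H ->
    u \in nth [::] H i -> v \in nth [::] H j ->
    occ D u i = occ D v j -> u = v /\ i = j;
  term_distinct : injective (term D);
  term_fresh : forall u v, term D u \notin occs D v;
  tree_valid : forall v, valid_tree c D v;
  tree_disjoint : forall u v w,
    w \in nodes (tree D u) -> w \in nodes (tree D v) -> u = v;
  tree_cover : forall w, exists v, w \in nodes (tree D v)
}.

Definition split_hypergraph D : hypergraph W :=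
  mkseq (fun i => [seq occ D v i | v <- nth [::] H i]) (size H)
  ++ flatten [seq [seq [:: e.1; e.2] | e <- edges (tree D v)] | v <- enum V].

Definition hat D (S : {set V}) : {set W} :=
  \bigcup_(v in S) [set w in nodes (tree D v)].

Definition unhat D (T : {set W}) : {set V} := [set v | term D v \in T].

End Splitting.

(* Word RAM: finitely many arrays of machine words, with a scalar being cell 0
   of an array.  Words are the numbers below [w], and the programs below get
   [w = O(L)], i.e. words of log L + O(1) bits.  A given program contains
   finitely many expressions, each of constant size, so that charging one time
   unit per assignment or test counts elementary steps up to a constant
   factor. *)
Inductive expr :=
  | Lit of nat
  | Get of nat & expr
  | Add of expr & expr
  | Sub of expr & expr.

Inductive prog :=
  | Skip
  | Put of nat & expr & expr
  | Seq of prog & prog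
  | If of expr & prog & prog
  | While of expr & prog.

Definition memory := nat -> nat -> nat.

Definition update (s : memory) (a i x : nat) : memory :=
  fun b j => if (b == a) && (j == i) then x else s b j.

Fixpoint eval (s : memory) (e : expr) : nat :=
  match e with
  | Lit n => n
  | Get a e1 => s a (eval s e1)
  | Add e1 e2 => eval s e1 + eval s e2
  | Sub e1 e2 => eval s e1 - eval s e2
  end.

(* [exec w p s t s']: started in memory [s], [p] halts after [t] steps in
   memory [s'], all addresses and values written being below [w]. *)
Inductive exec (w : nat) : prog -> memory -> nat -> memory -> Prop :=
  | ExecSkip s : exec w Skip s 0 s
  | ExecPut s a i e : eval s i < w -> eval s e < w ->
      exec w (Put a i e) s 1 (update s a (eval s i) (eval s e))
  | ExecSeq p q s t s' t' s'' :
      exec w p s t s' -> exec w q s' t' s'' -> exec w (Seq p q) s (t + t') s''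
  | ExecIfTrue e p q s t s' :
      eval s e != 0 -> exec w p s t s' -> exec w (If e p q) s t.+1 s'
  | ExecIfFalse e p q s t s' :
      eval s e = 0 -> exec w q s t s' -> exec w (If e p q) s t.+1 s'
  | ExecWhileTrue e p s t s' t' s'' :
      eval s e != 0 -> exec w p s t s' -> exec w (While e p) s' t' s'' ->
      exec w (While e p) s (t + t').+1 s''
  | ExecWhileFalse e p s :
      eval s e = 0 -> exec w (While e p) s 1 s.

Definition load (ins : seq (seq nat)) : memory :=
  fun a i => nth 0 (nth [::] ins a) i.

(* The input lists are placed in the first arrays, all other cells being zero;
   the output lists are found in the arrays following the input ones. *)
Definition computes_within (w tmax : nat) (p : prog)
    (ins outs : seq (seq nat)) : Prop :=
  exists t s, [/\ exec w p (load ins) t s, t <= tmax &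
    forall k i, k < size outs -> i < size (nth [::] outs k) ->
      s (size ins + k) i = nth 0 (nth [::] outs k) i].

(* Encodings: elements of a finite set are numbered from 0. *)
Definition code_elt (V : finType) (v : V) : nat := enum_rank v.

Definition code_list (V : finType) (l : seq V) : seq nat :=
  size l :: [seq code_elt v | v <- l].

Definition code_hypergraph (V : finType) (H : hypergraph V) : seq nat :=
  #|V| :: size H :: flatten [seq code_list A | A <- H].

(* Tables describing the blocks B_v and the terminals: the blocks are listed
   one after the other in [code_blocks], the block of the [k]-th vertex
   occupying the positions from entry [k] (included) to entry [k.+1] (excluded)
   of [code_starts]; [code_terminals] holds, for each element, one plus the
   number of [v] if the element is t_v, and 0 if it is not a terminal. *)
Section Tables.
Variables (V : finType) (H : hypergraph V) (W : finType) (D : splitting H W).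

Definition code_starts : seq nat :=
  0 :: scanl addn 0 [seq size (nodes (tree D v)) | v <- enum V].

Definition code_blocks : seq nat :=
  flatten [seq [seq code_elt w | w <- nodes (tree D v)] | v <- enum V].

Definition code_terminals : seq nat :=
  [seq if [pick v | term D v == w] is Some v then (code_elt v).+1 else 0
     | w <- enum W].

Definition code_tables : seq (seq nat) :=
  [:: code_starts; code_blocks; code_terminals].

End Tables.

(* Main.v *)
Require Import Defs.
From mathcomp Require Import all_boot zify.

Set Implicit Arguments.
Unset Strict Implicit.
Unset Printing Implicit Defensive.

(** Along a tree edge a stopping set contains both ends or neither, since the
    edge is a two-element hyperedge.  The trees are connected, so a stopping set
    of the split hypergraph is a union of whole blocks B_v, that is, a set
    [hat D S] with S read off from the terminals ([unhatK]).  A hyperedge A and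
    its copy on occurrence elements meet S and [hat D S] in equally many points,
    because the occurrence elements of A lie in pairwise distinct blocks;
    hence [hat D S] is stopping exactly when S is ([hat_stopping]), and [hat D]
    is an isomorphism of the inclusion orders.  A set violates a Horn clause
    coming from A exactly when its complement meets A in a single point, so
    models are the complements of stopping sets ([model_stopping]), and coatoms
    are the complements of minimal nonempty stopping sets.

    An occurrence element lies in one copied hyperedge and is a leaf of its
    tree; the other elements lie in no copied hyperedge and have tree degree at
    most three.  This gives the degree bound, and the remaining structural
    claims compare copies with originals one hyperedge at a time.  The length
    bound holds since the d_v sum to at most the number of listed incidences.

    For the algorithmic part, the program logic [runs] carries a time bound, and
    each loop gets an invariant that describes every array by an explicit list.
    The two set maps copy blocks, respectively look up terminals.  The build
    program produces one particular splitting, whose trees are caterpillars: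
    with d occurrences, the block is a run of max(1, 2d) consecutive numbers,
    the occurrences get the even positions, the odd positions form a path
    leaving the first occurrence, every later occurrence hangs from the odd
    position before it, and the last position is the terminal.  The parent of a
    position is then a simple arithmetic function ([caterpillar_parent]), and
    the r-th occurrence of v is at twice r after the start of the block of v, so
    that one pass over the input finds the relative positions, a second pass
    over the vertices finds the block starts and writes the edges, and a third
    pass adds the starts. *)

(** * Models and stopping sets are complementary *)

Section Coatoms.
Variables (V : finType) (H : hypergraph V).
Implicit Types (S M : {set V}).

(** A clause [A minus v -> v] fails on M exactly when v is the only element of A
    outside M; so M is a model iff its complement never meets a hyperedge once. *)
Lemma model_stopping M : (M \in models (horn_cnf H)) = (~: M \in Stop H).
Proof.
rewrite !inE /stopping /horn_cnf; elim: H => //= A H' <-.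
rewrite all_cat; congr andb; rewrite all_map; apply/allP/idP => [modM|].
  apply/negP => /cards1P [v AMv].
  have: v \in [set v in A] :&: ~: M by rewrite AMv set11.
  rewrite !inE => /andP [vA vM]; move: (modM v vA) => /=.
  rewrite (negPf vM) implybF => /negP; apply; apply/subsetP => u.
  rewrite !inE => /andP [uv uA]; apply/negPn/negP => uM.
  have: u \in [set v in A] :&: ~: M by rewrite !inE uA uM.
  by rewrite AMv inE (negPf uv).
move=> AM v vA /=; apply/implyP => /subsetP AvM.
apply/negPn/negP => vM; case/negP: AM; apply/cards1P; exists v.
apply/setP => u; rewrite !inE; have [-> | uv] := eqVneq u v; first by rewrite vA vM.
apply/negP => /andP [uA uM]; case/negP: uM; apply: AvM.
by rewrite !inE uv uA.
Qed.

(** Complementation reverses inclusion and exchanges the full and the empty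
    set. *)
Lemma coatoms_stopping :
  coatoms (models (horn_cnf H)) = [set ~: S | S in minimal_nonempty (Stop H)].
Proof.
have modT (X : {set V}) : (X != setT) = (~: X != set0).
  by rewrite -(inj_eq (@setC_inj V)) setCT.
apply/setP => M; rewrite -[M in RHS]setCK (mem_imset _ _ (@setC_inj V)) !inE.
apply/maxsetP/minsetP => /= - [/andP [MF MT] Mmax]; split.
- by rewrite -model_stopping MF -modT.
- move=> S /andP [SF S0] SM; apply: (can_inj (@setCK V)); rewrite setCK.
  apply: Mmax; last by rewrite -(setCK M) setCS.
  by rewrite model_stopping modT setCK SF S0.
- by rewrite model_stopping MF modT.
- move=> N /andP [NF NT] MN; apply: (can_inj (@setCK V)).
  by apply: Mmax; rewrite ?setCS // -model_stopping NF -modT.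
Qed.

End Coatoms.

(** * Stopping sets, degrees and sizes of a split hypergraph *)

Section ValidSplittings.
Variables (c : nat) (V : finType) (H : hypergraph V) (W : finType).
Variables (D : splitting H W) (valD : valid_splitting c D).
Implicit Types (S : {set V}) (T : {set W}) (v : V) (w : W).

Local Notation B v := (nodes (tree D v)).

(** The three shapes a tree may have, according to whether the vertex has no, one
    or several occurrences. *)
Variant tree_spec v : Prop :=
  | TreePoint of occs D v = set0 & B v = [:: term D v] & edges (tree D v) = [::]
  | TreeEdge w of occs D v = [set w] & uniq (B v) & B v =i [set term D v; w]
      & edge_sets (tree D v) = [:: [set term D v; w]]
  | TreeCubic of is_tree (tree D v)
      & {in B v, forall x, degree (tree D v) x <= 3}
      & leaves (tree D v) = term D v |: occs D v
      & size (B v) <= c * #|occs D v| & size (edges (tree D v)) <= c * #|occs D v|.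

Lemma treeP v : tree_spec v.
Proof.
move: (tree_valid valD v); rewrite /valid_tree.
case E: #|_| => [|[|d]]; [case=> n es | case=> u n es | case=> t dg l n es].
- by apply: TreePoint => //; apply: cards0_eq.
- by have /eqP/cards1P [w ow] := E; apply: (@TreeEdge v w); rewrite // -ow.
- by apply: TreeCubic; rewrite // E.
Qed.

Lemma occs_occ v i : i < size H -> v \in nth [::] H i -> occ D v i \in occs D v.
Proof. by move=> iH vi; apply/imsetP; exists (Ordinal iH); rewrite ?inE. Qed.

Lemma nodes_uniq v : uniq (B v).
Proof. by case: (treeP v) => [_ -> _ | w _ ? _ _ | [[? _ _] _ _ _] _ _ _ _]. Qed.

Lemma term_node v : term D v \in B v.
Proof.
case: (treeP v) => [_ -> _ | w _ _ -> _ | _ _ l _ _]; rewrite ?inE ?eqxx //.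
have: term D v \in leaves (tree D v) by rewrite l setU11.
by rewrite inE => /andP [].
Qed.

Lemma occs_node v w : w \in occs D v -> w \in B v.
Proof.
case: (treeP v) => [-> | x -> _ -> _ | _ _ l _ _]; first by rewrite inE.
  by rewrite !inE => ->; rewrite orbT.
move=> wo; have: w \in leaves (tree D v) by rewrite l setU1r.
by rewrite inE => /andP [].
Qed.

Lemma edge_sets_uniq v : uniq (edge_sets (tree D v)).
Proof.
by case: (treeP v) => [_ _ e | w _ _ _ -> | [[_ ? _] _ _ _] _ _ _ _];
  rewrite // /edge_sets e.
Qed.

Lemma edge_nodes v e : e \in edges (tree D v) ->
  [/\ e.1 \in B v, e.2 \in B v & e.1 != e.2].
Proof.
case: (treeP v) => [_ _ -> // | w ow _ Bv es eT | [[_ _ eP] _ _ _] _ _ _ _ /eP//].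
have: [set e.1; e.2] \in edge_sets (tree D v) by apply: map_f.
rewrite es inE => /eqP ew.
have tw : term D v != w by apply: contraNneq (term_fresh valD v v) => ->; rewrite ow set11.
split; try by rewrite Bv -ew !inE eqxx ?orbT.
apply: contraNneq tw => e12; apply/eqP.
have: #|[set term D v; w]| <= 1 by rewrite -ew e12 setUid cards1.
by rewrite cards2; case: eqP.
Qed.

Lemma tree_connected v : connected (tree D v).
Proof.
case: (treeP v) => [_ Bv _ | w _ _ Bv es | [_ _ ? _] _ _ _ _] //.
  by move=> x y; rewrite Bv !inE => /eqP -> /eqP ->; apply: connect0.
move=> x y; rewrite !Bv !inE.
have tw : adj (tree D v) (term D v) w by rewrite /adj es inE.
have wt : adj (tree D v) w (term D v) by rewrite /adj es inE setUC.
by do 2! case/orP => /eqP ->; rewrite ?connect0 ?connect1.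
Qed.

(** An occurrence element leaves room for the copied hyperedge that it belongs
    to: it has tree degree one. *)
Lemma degree_occs v w :
  w \in B v -> degree (tree D v) w + (w \in occs D v) <= 3.
Proof.
case: (treeP v) => [ow _ e _ | u ow _ _ es _ | _ d3 l _ _ wB].
- rewrite ow inE addn0 /degree eq_card0 // => x.
  by rewrite inE /adj /edge_sets e.
- rewrite (leq_add (_ : _ <= 2) (leq_b1 _)) //.
  apply: (leq_trans _ (_ : #|[set term D v; u]| <= 2)); last by rewrite cards2; case: eqP.
  apply/subset_leq_card/subsetP => x; rewrite inE /adj es inE => /eqP <-.
  by rewrite !inE eqxx orbT.
- case wo: (w \in _); last by rewrite addn0 d3.
  have: w \in leaves (tree D v) by rewrite l setU1r.
  by rewrite inE => /andP [_ /eqP ->].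
Qed.

Lemma nodes_disjoint u v w : w \in B u -> w \in B v -> u = v.
Proof. exact: (tree_disjoint valD). Qed.

Lemma occ_node v i : i < size H -> v \in nth [::] H i -> occ D v i \in B v.
Proof. by move=> iH vi; apply/occs_node/occs_occ. Qed.

Lemma mem_hat S v w : w \in B v -> (w \in hat D S) = (v \in S).
Proof.
move=> wv; apply/bigcupP/idP => [[u uS]|vS]; last by exists v; rewrite ?inE.
by rewrite inE => /nodes_disjoint - /(_ _ wv) <-.
Qed.

Lemma hatK : cancel (hat D) (unhat D).
Proof. by move=> S; apply/setP => v; rewrite inE (mem_hat _ (term_node v)). Qed.

Lemma hat_subset S S' : (hat D S \subset hat D S') = (S \subset S').
Proof.
apply/subsetP/subsetP => sub x; last first.
  have [v xv] := tree_cover valD x.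
  by rewrite !(mem_hat _ xv); apply: sub.
by have := sub (term D x); rewrite !(mem_hat _ (term_node x)).
Qed.

Lemma hat0 : hat D set0 = set0.
Proof. by rewrite /hat big_set0. Qed.

Lemma split_hyperedgeP (A : seq W) :
  reflect ((exists2 i, i < size H & A = [seq occ D v i | v <- nth [::] H i]) \/
           (exists v, exists2 e, e \in edges (tree D v) & A = [:: e.1; e.2]))
          (A \in split_hypergraph D).
Proof.
rewrite mem_cat; apply: (iffP orP) => [[/mapP [i]|/flatten_mapP [v _ /mapP [e eT ->]]]|].
- by rewrite mem_iota add0n => iH ->; left; exists i.
- by right; exists v, e.
case=> [[i iH ->]|[v [e eT ->]]]; [left|right].
  by apply/mapP; exists i; rewrite // mem_iota.
by apply/flatten_mapP; exists v; rewrite ?mem_enum //; apply: map_f.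
Qed.

Lemma occ_inj i : i < size H -> {in nth [::] H i &, injective (occ D ^~ i)}.
Proof. by move=> iH u v ui vi /(occ_distinct valD iH iH ui vi) []. Qed.

Lemma occ_hyperedge i : [set w in [seq occ D v i | v <- nth [::] H i]]
  = [set occ D v i | v in [set v in nth [::] H i]].
Proof.
apply/setP => w; rewrite inE; apply/mapP/imsetP => - [v vi ->]; exists v => //.
  by rewrite inE.
by rewrite inE in vi.
Qed.

Lemma card_occ_hyperedge i : i < size H ->
  #|[seq occ D v i | v <- nth [::] H i]| = #|nth [::] H i|.
Proof.
move=> iH; have := card_in_imset (f := occ D ^~ i) (D := [set v in nth [::] H i]).
rewrite -occ_hyperedge !cardsE; apply => u v.
by rewrite !inE; apply: occ_inj.
Qed.

Lemma card_edge (x y : W) : x != y -> #|[:: x; y]| = 2.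
Proof. by move=> xy; rewrite (card_uniqP _) //= inE xy. Qed.

(** Membership propagates along the edges of a connected tree. *)
Lemma stopping_closed_tree T v w w' : stopping (split_hypergraph D) T ->
  w \in B v -> w' \in B v -> w \in T -> w' \in T.
Proof.
move=> /allP stT wv w'v.
have adjT x y : adj (tree D v) x y -> x \in T -> y \in T.
  move=> /mapP [e eT exy] xT; apply/negPn/negP => yT.
  have /stT : [:: e.1; e.2] \in split_hypergraph D.
    by apply/split_hyperedgeP; right; exists v, e.
  have -> : [set w in [:: e.1; e.2]] = [set x; y].
    by rewrite exy; apply/setP => z; rewrite !inE.
  case/negP; apply/cards1P; exists x; apply/setP => z; rewrite !inE.
  have [-> | zx] := eqVneq z x; first by rewrite xT.
  by have [-> | //] := eqVneq z y; rewrite (negPf yT).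
have /connectP [p] := tree_connected wv w'v.
elim: p w {wv} => [|x p IHp] w /= ; first by move=> _ -> .
by move=> /andP [/adjT wx pth] lst wT; apply: IHp lst (wx wT).
Qed.

(** The copy of A meets [hat D S] in as many points as A meets S, and an edge of
    the tree of v lies inside [hat D S] or avoids it, according to whether v is
    in S; so edges impose nothing. *)
Lemma hat_stopping S : (hat D S \in Stop (split_hypergraph D)) = (S \in Stop H).
Proof.
rewrite !inE.
have occS i : i < size H -> #|[set w in [seq occ D v i | v <- nth [::] H i]] :&: hat D S|
    = #|[set v in nth [::] H i] :&: S|.
  move=> iH; rewrite occ_hyperedge.
  have -> : [set occ D v i | v in [set v in nth [::] H i]] :&: hat D S
     = [set occ D v i | v in [set v in nth [::] H i] :&: S].
    apply/setP => w; rewrite inE; apply/andP/imsetP => [[/imsetP [v]]|[v]].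
      rewrite inE => vi -> ; rewrite (mem_hat _ (occ_node iH vi)) => vS.
      by exists v; rewrite ?inE ?vi.
    rewrite !inE => /andP [vi vS] ->; rewrite (mem_hat _ (occ_node iH vi)).
    by split=> //; apply: imset_f; rewrite inE.
  rewrite card_in_imset // => u v; rewrite !inE => /andP [ui _] /andP [vi _].
  exact: occ_inj.
apply/allP/allP => st A.
  move=> /(nthP [::]) [i iH <-]; rewrite -occS //; apply: st.
  by apply/split_hyperedgeP; left; exists i.
move=> /split_hyperedgeP [[i iH ->]|[v [e eT ->]]].
  by rewrite occS //; apply/st/mem_nth.
have [e1 e2 e12] := edge_nodes eT.
have hatE x : (x \in [:: e.1; e.2]) && (x \in hat D S) = (x \in [:: e.1; e.2]) && (v \in S).
  rewrite !inE; have [->|_] := eqVneq x e.1; first by rewrite (mem_hat _ e1).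
  by have [->|//] := eqVneq x e.2; rewrite (mem_hat _ e2).
have -> : [set w in [:: e.1; e.2]] :&: hat D S
    = [set x in [:: e.1; e.2] | v \in S].
  by apply/setP => x; move: (hatE x); rewrite !inE.
case: (v \in S); last by rewrite eq_card0 // => x; rewrite !inE andbF.
have -> : #|[set x in [:: e.1; e.2] | true]| = 2; last by [].
by rewrite -(card_edge e12) -cardsE; apply: eq_card => x; rewrite !inE andbT.
Qed.

(** A stopping set is a union of blocks, each of which is detected by its
    terminal. *)
Lemma unhatK : {in Stop (split_hypergraph D), cancel (unhat D) (hat D)}.
Proof.
move=> T; rewrite inE => stT; apply/setP => w.
have [v wv] := tree_cover valD w; rewrite (mem_hat _ wv) inE.
by apply/idP/idP; apply: (stopping_closed_tree (v := v) stT) => //; apply: term_node.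
Qed.

Lemma hat_iso : subset_iso (hat D) (Stop H) (Stop (split_hypergraph D)).
Proof.
split; last by move=> S S' _ _; apply: hat_subset.
split; first by move=> S S' _ _; apply: (can_inj hatK).
apply/setP => T; apply/imsetP/idP => [[S SH ->]|TH]; first by rewrite hat_stopping.
by exists (unhat D T); rewrite -?hat_stopping (unhatK TH).
Qed.

Lemma hat_eq0 S : (hat D S == set0) = (S == set0).
Proof. by rewrite -hat0 (inj_eq (can_inj hatK)). Qed.

Lemma hat_minimal S : (hat D S \in minimal_nonempty (Stop (split_hypergraph D)))
  = (S \in minimal_nonempty (Stop H)).
Proof.
rewrite !inE; apply/minsetP/minsetP => /= - [/andP [SF S0] Smin].
  split; first by rewrite -hat_stopping SF -hat_eq0.
  move=> S' /andP [S'F S'0] sub; apply: (can_inj hatK); apply: Smin.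
    by rewrite hat_stopping S'F hat_eq0.
  by rewrite hat_subset.
split; first by rewrite hat_stopping SF hat_eq0.
move=> T /andP [TF T0] sub; rewrite -(unhatK TF); congr hat; apply: Smin.
  by rewrite -hat_stopping -hat_eq0 unhatK // TF.
by rewrite -hat_subset unhatK.
Qed.

Lemma hat_minimal_bij : bij_between (hat D) (minimal_nonempty (Stop H))
  (minimal_nonempty (Stop (split_hypergraph D))).
Proof.
split; first by move=> S S' _ _; apply: (can_inj hatK).
apply/setP => T; apply/imsetP/idP => [[S SH ->]|TH]; first by rewrite hat_minimal.
have TF : T \in Stop (split_hypergraph D).
  by move: TH; rewrite inE => /minsetP [/andP []].
by exists (unhat D T); rewrite -?hat_minimal (unhatK TF).
Qed.

Lemma hat_coatoms_bij : bij_between (fun M : {set V} => ~: hat D (~: M))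
  (coatoms (models (horn_cnf H))) (coatoms (models (horn_cnf (split_hypergraph D)))).
Proof.
rewrite !coatoms_stopping; split.
  by move=> M N _ _ /(can_inj (@setCK _))/(can_inj hatK)/(can_inj (@setCK _)).
have [_ <-] := hat_minimal_bij; rewrite -!imset_comp.
by apply: eq_imset => S /=; rewrite setCK.
Qed.

(** As the edge sets are pairwise distinct, an edge at w is determined by its
    other end. *)
Lemma count_tree_edges v w : w \in B v ->
  count (fun e => w \in [:: e.1; e.2]) (edges (tree D v)) <= degree (tree D v) w.
Proof.
move=> wv; rewrite /degree cardE -(size_map (fun y => [set w; y])).
have -> : count (fun e => w \in [:: e.1; e.2]) (edges (tree D v))
    = count (fun X : {set W} => w \in X) (edge_sets (tree D v)).
  by rewrite count_map; apply: eq_count => e; rewrite /= !inE.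
rewrite -size_filter; apply: uniq_leq_size; first by rewrite filter_uniq // edge_sets_uniq.
move=> X; rewrite mem_filter => /andP [wX XE].
have [e eT Xe] := mapP XE; apply/mapP.
have [y Xy] : exists y, X = [set w; y].
  move: wX; rewrite Xe !inE => /orP [] /eqP ->; first by exists e.2.
  by exists e.1; rewrite setUC.
by exists y; rewrite // mem_enum inE /adj -Xy.
Qed.

(** Only the tree of the block containing w, and at most one copied hyperedge,
    can contribute to the degree of w. *)
Lemma max_degree_split : max_degree (split_hypergraph D) <= 3.
Proof.
apply/bigmax_leqP => w _; have [v wv] := tree_cover valD w.
apply: leq_trans (degree_occs wv); rewrite count_cat addnC leq_add //.
  rewrite count_flatten -map_comp sumnE big_map big_enum /=.
  rewrite (bigD1 v) //= big1 ?addn0; last first.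
    move=> u uv; rewrite count_map; apply/eqP; rewrite eqn0Ngt -has_count.
    apply: contraNN uv => /hasP [e /edge_nodes [e1 e2 _]] /=.
    by rewrite !inE => /orP [] /eqP we; apply/eqP; apply: nodes_disjoint wv; rewrite we.
  by rewrite count_map count_tree_edges.
have occi i : i < size H -> w \in [seq occ D v i | v <- nth [::] H i] ->
    [/\ v \in nth [::] H i, w = occ D v i & w \in occs D v].
  move=> iH /mapP [u ui wu]; have uv : u = v.
    by apply: nodes_disjoint wv; rewrite wu occ_node.
  by subst u; split=> //; rewrite wu occs_occ.
have [wo|wo] := boolP (w \in occs D v); last first.
  rewrite leqn0 eqn0Ngt -has_count; apply/hasPn => A /mapP [i].
  rewrite mem_iota => iH ->; apply: contraNN wo => /occi []//.
rewrite count_map -size_filter.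
case E: [seq _ <- _ | _] => [//|i [//|j s]].
have fu : uniq (filter
    (preim (fun i => [seq occ D v i | v <- nth [::] H i]) (fun A => w \in A)) (iota 0 (size H))).
  by rewrite filter_uniq ?iota_uniq.
have : i \in i :: j :: s by rewrite inE eqxx.
rewrite -E mem_filter mem_iota add0n /= => /andP [/occi + iH] => /(_ iH) [vi wi _].
have : j \in i :: j :: s by rewrite !inE eqxx orbT.
rewrite -E mem_filter mem_iota add0n /= => /andP [/occi + jH] => /(_ jH) [vj wj _].
have [_ ij] := occ_distinct valD iH jH vi vj (etrans (esym wi) wj).
by move: fu; rewrite E ij /= inE eqxx.
Qed.

Lemma rank_split : rank (split_hypergraph D) <= maxn 2 (rank H).
Proof.
apply/bigmax_leqP_seq => A /split_hyperedgeP [[i iH ->]|[v [e eT ->]]] _.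
  by rewrite card_occ_hyperedge // leq_max leq_bigmax_seq ?orbT // mem_nth.
by have [_ _ /card_edge ->] := edge_nodes eT; rewrite leq_maxl.
Qed.

Lemma split_size23 : all (fun A : seq V => (#|A| == 2) || (#|A| == 3)) H ->
  all (fun A : seq W => (#|A| == 2) || (#|A| == 3)) (split_hypergraph D).
Proof.
move=> /allP H23; apply/allP => A /split_hyperedgeP [[i iH ->]|[v [e eT ->]]].
  by rewrite card_occ_hyperedge //; apply/H23/mem_nth.
by have [_ _ /card_edge ->] := edge_nodes eT.
Qed.


(** Copied hyperedges are nonempty and disjoint, edges of different trees are disjoint,
    and a copied hyperedge meets each block at most once, whereas an edge lies
    inside one block. *)
Lemma split_normalized : normalized H -> normalized (split_hypergraph D).
Proof.
case=> /allP Hu Hs H0; split.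
- apply/allP => A /split_hyperedgeP [[i iH ->]|[v [e eT ->]]].
    by rewrite map_inj_in_uniq ?Hu ?mem_nth //; apply: occ_inj.
  by have [_ _] := edge_nodes eT; rewrite /= inE => ->.
- have setE (x y : W) : [set w in [:: x; y]] = [set x; y].
    by apply/setP => w; rewrite !inE.
  rewrite map_cat cat_uniq; apply/and3P; split.
  + rewrite -map_comp map_inj_in_uniq ?iota_uniq // => i j.
    rewrite !mem_iota !add0n /= => iH jH /setP eqij.
    have [v vi] : exists v, v \in nth [::] H i.
      have := mem_nth [::] iH; case: (nth _ H i) => [|v A _]; first by rewrite (negPf H0).
      by exists v; rewrite mem_head.
    have /mapP [u uj ou] : occ D v i \in [seq occ D u j | u <- nth [::] H j].
      by have := eqij (occ D v i); rewrite !inE => <-; apply: (map_f (occ D ^~ i)).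
    by have [_ ->] := occ_distinct valD iH jH vi uj ou.
  + apply/hasPn => X; rewrite map_flatten => /flatten_mapP [_ /mapP [v _ ->]].
    rewrite -map_comp => /mapP [e eT /= ->]; rewrite setE.
    have [e1 e2 /eqP e12] := edge_nodes eT.
    apply/mapP => -[_ /mapP [i + ->]]; rewrite mem_iota add0n /= => iH /setP eqA.
    have := eqA e.1; rewrite !inE eqxx /= => /esym/mapP [u ui eu].
    have := eqA e.2; rewrite !inE eqxx orbT => /esym/mapP [u' u'i eu'].
    apply: e12; rewrite eu eu'; congr occ.
    have -> : u = v by apply: nodes_disjoint e1; rewrite eu occ_node.
    by apply/esym; apply: nodes_disjoint e2; rewrite eu' occ_node.
  + rewrite map_flatten -map_comp.
    have : uniq (enum V) by apply: enum_uniq.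
    elim: (enum V) => //= v vs IHvs /andP [vvs /IHvs uvs].
    rewrite cat_uniq uvs andbT; apply/andP; split.
      have -> // : [seq [set w in A] | A <- [seq [:: e.1; e.2] | e <- edges (tree D v)]]
          = edge_sets (tree D v).
        by rewrite -map_comp; apply: eq_map => e; apply: setE.
      exact: edge_sets_uniq.
    apply/hasPn => X /flatten_mapP [u uvs' /=]; rewrite -!map_comp.
    move=> /mapP [e eT /= ->]; apply: contraNN vvs => /mapP [e' e'T /= /setP].
    move=> /(_ e.1); rewrite !setE !inE eqxx /= => /esym.
    have [e1 _ _] := edge_nodes eT; have [e'1 e'2 _] := edge_nodes e'T.
    move=> /orP [] /eqP ee; suff -> : v = u by []; apply: nodes_disjoint e1;
    by rewrite ee.
- by apply/split_hyperedgeP => -[[i iH /esym/(congr1 size)]|[v [e]] //];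
    rewrite size_map => /size0nil i0; case/negP: H0; rewrite -i0 mem_nth.
Qed.

(** Double counting of incidences; a repeated incidence of v in a hyperedge
    counts once on the left. *)
Lemma sum_occs : \sum_(v : V) #|occs D v| <= \sum_(A <- H) size A.
Proof.
have dv v : #|occs D v| <= \sum_(i < size H) (v \in nth [::] H i).
  apply: (leq_trans (leq_imset_card _ _)).
  by rewrite -sum1_card big_mkcond; apply: leq_sum => i _; rewrite !inE; case: ifP.
apply: leq_trans (_ : \sum_(v : V) \sum_(i < size H) (v \in nth [::] H i) <= _).
  by apply: leq_sum => v _; apply: dv.
rewrite exchange_big (big_nth [::]) big_mkord.
apply: leq_sum => i _ /=; apply: leq_trans (card_size _).
by rewrite -sum1_card [leqRHS]big_mkcond /=; apply: leq_sum => v _; case: ifP.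
Qed.

(** The bound c * d_v only concerns vertices with at least two occurrences; the
    summand 2 takes care of the others. *)
Lemma tree_size v : size (B v) <= 2 + c * #|occs D v| /\
  size (edges (tree D v)) <= 2 + c * #|occs D v|.
Proof.
case: (treeP v) => [_ -> -> | w _ u Bv es | _ _ _ n e] //; last first.
  by split; apply: leq_trans (leq_addl _ _).
split; last first.
  by have := congr1 size es; rewrite size_map /= => ->; rewrite leq_addr.
rewrite -(card_uniqP u) (eq_card Bv) (leq_trans _ (leq_addr _ _)) //.
by rewrite cards2; case: eqP.
Qed.

Lemma blocks_perm : perm_eq (flatten [seq B v | v <- enum V]) (enum W).
Proof.
apply: uniq_perm (enum_uniq _) _; last first.
  move=> w; rewrite mem_enum; have [v wv] := tree_cover valD w.
  by apply/flatten_mapP; exists v; rewrite ?mem_enum.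
elim: (enum V) (enum_uniq V) => //= v vs IHvs /andP [vvs /IHvs uvs].
rewrite cat_uniq uvs nodes_uniq andbT; apply/hasPn => w /flatten_mapP [u uvs' wu].
by apply: contraNN vvs => wv; rewrite (nodes_disjoint wv wu).
Qed.

Lemma sum_blocks : \sum_(v : V) size (B v) = #|W|.
Proof.
by rewrite cardE -(perm_size blocks_perm) size_flatten /shape -map_comp sumnE big_map big_enum.
Qed.

Lemma incidence_length_split :
  incidence_length (split_hypergraph D) <= (4 * c + 9) * incidence_length H.
Proof.
rewrite /incidence_length.
have <- : \sum_(v : V) size (B v) = #|W| := sum_blocks.
have -> : size (split_hypergraph D) = size H + \sum_(v : V) size (edges (tree D v)).
  rewrite size_cat size_mkseq size_flatten /shape -map_comp sumnE big_map big_enum.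
  by congr (_ + _); apply: eq_bigr => v _; rewrite /= size_map.
have -> : \sum_(A <- split_hypergraph D) size A
    = \sum_(A <- H) size A + 2 * \sum_(v : V) size (edges (tree D v)).
  rewrite big_cat big_map; congr (_ + _).
    rewrite [RHS](big_nth [::]) /index_iota subn0.
    by apply: eq_bigr => i _; rewrite size_map.
  rewrite big_flatten big_map big_enum big_distrr; apply: eq_bigr => v _ /=.
  by rewrite big_map /= big_const_seq count_predT iter_addn_0.
have sum_le (f : V -> nat) : (forall v, f v <= 2 + c * #|occs D v|) ->
    \sum_(v : V) f v <= 2 * #|V| + c * \sum_(A <- H) size A.
  move=> fle; apply: leq_trans (_ : \sum_(v : V) (2 + c * #|occs D v|) <= _).
    by apply: leq_sum => v _; apply: fle.
  rewrite big_split /= sum_nat_const mulnC -big_distrr leq_add2l.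
  by rewrite leq_mul2l sum_occs orbT.
have := sum_le _ (fun v => proj1 (tree_size v)).
have := sum_le _ (fun v => proj2 (tree_size v)).
nia.
Qed.

End ValidSplittings.

(** * Numberings of finite sets *)

Lemma code_lt (V : finType) (v : V) : code_elt v < #|V|.
Proof. exact: ltn_ord. Qed.

Lemma code_inj (V : finType) : injective (@code_elt V).
Proof. by move=> u v /val_inj/enum_rank_inj. Qed.

Lemma code_ord n (i : 'I_n) : code_elt i = i.
Proof. by rewrite /code_elt enum_rank_ord. Qed.

(** The numbering follows the enumeration order, which is what turns tables
    indexed by vertices into tables indexed by numbers. *)
Lemma code_enum (V : finType) : [seq code_elt v | v <- enum V] = iota 0 #|V|.
Proof.
apply: (@eq_from_nth _ 0); first by rewrite size_map size_iota cardE.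
move=> i; rewrite size_map -cardE => iV; rewrite nth_iota // add0n.
set v0 := enum_val (Ordinal iV); rewrite (nth_map v0) -?cardE //.
by rewrite -[i in nth _ _ i]/(val (Ordinal iV)) -enum_val_nth /code_elt enum_valK.
Qed.

Lemma map_code_enum (V : finType) (T : Type) (h : nat -> T) :
  [seq h (code_elt v) | v <- enum V] = mkseq h #|V|.
Proof. by rewrite /mkseq -code_enum -map_comp. Qed.

Lemma code_onto (V : finType) k : k < #|V| -> exists v : V, code_elt v = k.
Proof. by move=> kV; exists (enum_val (Ordinal kV)); rewrite /code_elt enum_valK. Qed.

(** * Running programs: invariants and time bounds *)

Local Notation reg a := (Get a (Lit 0)).
Local Notation "p ;; q" := (Seq p q) (at level 61, right associativity).

Section Runs.
Variable w : nat.
Implicit Types (p q : prog) (e i : expr) (s : memory) (Q : memory -> Prop).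

(** Total correctness with a time bound: from [s], program [p] halts within [t]
    steps in a memory satisfying [Q].  Passing the continuation through [Q], as
    in [runs_seq], lets a program be executed symbolically from left to right. *)
Definition runs p s t Q : Prop :=
  exists t' s', [/\ exec w p s t' s', t' <= t & Q s'].

Lemma runs_le p s t t' Q Q' : t <= t' -> (forall s', Q s' -> Q' s') ->
  runs p s t Q -> runs p s t' Q'.
Proof.
by move=> tt' QQ' [u [s' [ex ut Qs]]]; exists u, s'; split; [|exact: leq_trans tt'|exact: QQ'].
Qed.

Lemma runs_skip s t Q : Q s -> runs Skip s t Q.
Proof. by exists 0, s; split=> //; constructor. Qed.

Lemma runs_put a i e s t Q : eval s i < w -> eval s e < w ->
  Q (update s a (eval s i) (eval s e)) -> runs (Put a i e) s t.+1 Q.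
Proof. by move=> iw ew Qs; exists 1; eexists; split; [constructor| |exact: Qs]. Qed.

Lemma runs_seq p q s t t' Q :
  runs p s t (fun s' => runs q s' t' Q) -> runs (p ;; q) s (t + t') Q.
Proof.
case=> u [s' [ex ut [u' [s'' [ex' ut' Qs]]]]].
by exists (u + u'), s''; split; [exact: ExecSeq ex ex'|exact: leq_add|].
Qed.

Lemma runs_put_seq a i e q s t Q : eval s i < w -> eval s e < w ->
  runs q (update s a (eval s i) (eval s e)) t Q -> runs (Put a i e ;; q) s t.+1 Q.
Proof. by move=> iw ew Qs; rewrite -add1n; apply: runs_seq; apply: runs_put. Qed.

Lemma runs_if e p q s t Q :
  (eval s e != 0 -> runs p s t Q) -> (eval s e = 0 -> runs q s t Q) ->
  runs (If e p q) s t.+1 Q.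
Proof.
move=> pR qR; case: (eqVneq (eval s e) 0) => e0.
  by have [u [s' [ex ut Qs]]] := qR e0; exists u.+1, s'; split=> //; apply: ExecIfFalse.
by have [u [s' [ex ut Qs]]] := pR e0; exists u.+1, s'; split=> //; apply: ExecIfTrue.
Qed.

(** The invariant is indexed by the number of completed rounds, and each round
    has its own time budget, so that nested loops add up to a linear bound. *)
Lemma runs_while (I : nat -> memory -> Prop) (n : nat) (tm : nat -> nat) e p s Q :
  I 0 s ->
  (forall k s', k < n -> I k s' -> eval s' e != 0 /\ runs p s' (tm k) (I k.+1)) ->
  (forall s', I n s' -> eval s' e = 0 /\ Q s') ->
  runs (While e p) s (\sum_(k < n) (tm k).+1).+1 Q.
Proof.
move=> I0 Ibody Iend.
suff /(_ 0 s) : forall k s', k <= n -> I k s' ->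
    runs (While e p) s' (\sum_(k <= j < n) (tm j).+1).+1 Q.
  by rewrite big_mkord; apply.
move=> k s' kn; rewrite -(subKn kn).
elim: (n - k) (leq_subr k n) s' => {k kn} [_|d IHd dn] s'.
  rewrite subn0 => /Iend [e0 Qs]; exists 1, s'; split=> //; exact: ExecWhileFalse.
move=> Ik; have kn : n - d.+1 < n by lia.
have [ne0 [u [s1 [ex ut Is1]]]] := Ibody _ _ kn Ik.
rewrite subnSK // in Is1; have [u' [s2 [ex' ut' Qs]]] := IHd (ltnW dn) _ Is1.
exists (u + u').+1, s2; split=> //; first exact: ExecWhileTrue ex ex'.
by rewrite big_ltn // subnSK // ltnS addSn -addnS leq_add // (leq_trans ut') // addSn.
Qed.

End Runs.

Lemma updateE s a i x b j :
  update s a i x b j = if (b == a) && (j == i) then x else s b j.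
Proof. by []. Qed.

(** Arrays start out zero and [nth 0] is zero beyond the end of a list, so an
    array that has been filled from the left is described at all addresses by a
    list, and writing the next cell appends to that list. *)
Lemma append_cell (f : nat -> nat) (l : seq nat) p x :
  (forall j, f j = nth 0 l j) -> p = size l ->
  forall j, (if j == p then x else f j) = nth 0 (rcons l x) j.
Proof.
by move=> fl -> j; rewrite nth_rcons fl; case: ltngtP => // lj; rewrite nth_default 1?ltnW.
Qed.

Lemma nth_pad (l : seq nat) k j : nth 0 (l ++ nseq k 0) j = nth 0 l j.
Proof. by rewrite nth_cat nth_nseq if_same; case: ltnP => // /(nth_default 0) ->. Qed.

(** Arrays that a phase has not yet touched; later phases rely on their zeros. *)
Definition clear (arrays : seq nat) (s : memory) :=
  forall a j, a \in arrays -> s a j = 0.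

Lemma clear_update arrays s a i x :
  a \notin arrays -> clear arrays s -> clear arrays (update s a i x).
Proof.
move=> anot sz b j bin; rewrite updateE; case: eqP => [ba|_]; last exact: sz.
by case/negP: anot; rewrite -ba.
Qed.

(** Discharges the clauses of an invariant on arrays that the last assignments
    left alone. *)
Ltac frame := try solve [move=> *; rewrite ?updateE /=; auto].

(** * Computing both set maps from the tables *)

(** Arrays 0 to 2 hold the starts, blocks and terminals, array 3 the input list
    and array 4 the output list, whose cell 0 is its length.  Register 5 is the
    position in the input list.  A terminal entry is one plus the vertex. *)
Definition unhat_prog : prog :=
  While (Defs.Sub (reg 3) (reg 5))
    (Put 5 (Lit 0) (Add (reg 5) (Lit 1)) ;;
     If (Get 2 (Get 3 (reg 5)))
       (Put 4 (Lit 0) (Add (reg 4) (Lit 1)) ;;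
        Put 4 (reg 4) (Defs.Sub (Get 2 (Get 3 (reg 5))) (Lit 1)))
       Skip).

(** Same layout, with register 6 running through the positions of the current
    block in array 1. *)
Definition hat_prog : prog :=
  While (Defs.Sub (reg 3) (reg 5))
    (Put 5 (Lit 0) (Add (reg 5) (Lit 1)) ;;
     Put 6 (Lit 0) (Get 0 (Get 3 (reg 5))) ;;
     While (Defs.Sub (Get 0 (Add (Get 3 (reg 5)) (Lit 1))) (reg 6))
       (Put 4 (Lit 0) (Add (reg 4) (Lit 1)) ;;
        Put 4 (reg 4) (Get 1 (reg 6)) ;;
        Put 6 (Lit 0) (Add (reg 6) (Lit 1)))).

(** Writing at address one plus the length, after the length in cell 0 was
    incremented, extends a list that is stored behind its length. *)
Lemma push_cell (f : nat -> nat) (l : seq nat) x y :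
  (forall j, f j = nth 0 (size l :: l) j) -> y = (size l).+1 ->
  forall j, (if j == y then x else if j == 0 then y else f j)
    = nth 0 (size (rcons l x) :: rcons l x) j.
Proof.
move=> fl -> [|j] /=; first by rewrite size_rcons.
by rewrite eqSS fl -(append_cell (p := size l) x (f := nth 0 l) (l := l)).
Qed.

Section TableProgs.
Variables (w : nat) (starts blocks terms : seq nat).

Definition block_entries v := [seq nth 0 blocks q |
  q <- iota (nth 0 starts v) (nth 0 starts v.+1 - nth 0 starts v)].

Definition terminal_owners (ts : seq nat) :=
  [seq x.-1 | x <- [seq nth 0 terms t | t <- ts] & x != 0].

Lemma unhat_prog_runs (ts : seq nat) (out := terminal_owners ts) :
  size ts < w -> all (fun x => x <= w) terms ->
  runs w unhat_prog (load [:: starts; blocks; terms; size ts :: ts]) (5 * size ts).+1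
    (fun s => forall j, s 4 j = nth 0 (size out :: out) j).
Proof.
move=> tw termw; set s0 := load _.
pose outk k := terminal_owners (take k ts).
have outk_size k : size (outk k) <= k.
  rewrite size_map size_filter (leq_trans (count_size _ _)) // size_map size_take.
  by case: ifP => // /negbT; rewrite -leqNgt.
pose I k (s : memory) := [/\ s 5 0 = k, forall j, s 4 j = nth 0 (size (outk k) :: outk k) j,
  forall j, s 2 j = nth 0 terms j & forall j, s 3 j = nth 0 (size ts :: ts) j].
apply: runs_le (_ : (\sum_(k < size ts) 4.+1).+1 <= _) (fun s Qs => Qs) _.
  by rewrite sum_nat_const card_ord mulnC.
apply: (runs_while (I := I) (tm := fun=> 4)).
- by split=> // j; rewrite /s0 /load /= /outk take0 /=; case: j => [|[|j]].
- move=> k s kn [s5 s4 s2 s3].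
  split; first by rewrite /= s3 s5 /=; lia.
  set x := nth 0 terms (nth 0 ts k).
  have xw : x <= w by rewrite /x; case: (ltnP (nth 0 ts k) (size terms)) =>
    [/(mem_nth 0)/(allP termw)|/(nth_default 0) ->].
  have outS : outk k.+1 = if x != 0 then rcons (outk k) x.-1 else outk k.
    rewrite /outk /terminal_owners (take_nth 0) // map_rcons filter_rcons -/x; case: ifP => //.
    by rewrite map_rcons.
  apply: runs_put_seq => /=; [lia|rewrite s5; lia|].
  apply: runs_if; rewrite /= ?updateE /= s5 addn1 s3 s2 /= -/x => x0.
    have := outk_size k => ?.
    apply: runs_put_seq; rewrite /= ?updateE /= ?s4 /=; [lia|lia|].
    apply: runs_put; rewrite /= ?updateE /= ?s4 ?s5 ?addn1 ?s3 ?s2 /= -/x; [lia|lia|].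
    rewrite /I outS x0; split=> [|j|j|j]; rewrite ?updateE //=.
    by rewrite subn1; apply: push_cell.
  apply: runs_skip; rewrite /I outS x0 /=; split=> // j; rewrite !updateE /=.
- move=> s [s5 s4 s2 s3]; rewrite /= s3 s5 subnn; split=> // j.
  by rewrite s4 /outk take_size.
Qed.

Lemma hat_prog_runs (vs : seq nat) (out := flatten [seq block_entries v | v <- vs]) :
  size vs < w -> size out < w -> all (fun x => x < w) blocks ->
  all (fun x => x < w) starts ->
  runs w hat_prog (load [:: starts; blocks; terms; size vs :: vs]) (4 * (size vs + size out)).+1
    (fun s => forall j, s 4 j = nth 0 (size out :: out) j).
Proof.
move=> tw outw blockw startw; set s0 := load _.
have bw q : nth 0 blocks q < w.
  case: (ltnP q (size blocks)) => [/(mem_nth 0)/(allP blockw)//|/(nth_default 0) ->].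
  by apply: leq_ltn_trans tw.
have sw q : nth 0 starts q < w.
  case: (ltnP q (size starts)) => [/(mem_nth 0)/(allP startw)//|/(nth_default 0) ->].
  by apply: leq_ltn_trans tw.
pose bs v := nth 0 starts v.+1 - nth 0 starts v.
pose block v l := [seq nth 0 blocks q | q <- iota (nth 0 starts v) l].
pose outk k := flatten [seq block v (bs v) | v <- take k vs].
have outkS k : k < size vs -> outk k.+1 = outk k ++ block (nth 0 vs k) (bs (nth 0 vs k)).
  by move=> kn; rewrite /outk (take_nth 0) // map_rcons flatten_rcons.
have outkw k : size (outk k) <= size out.
  rewrite /out -[in leqRHS](cat_take_drop k vs) map_cat flatten_cat size_cat; exact: leq_addr.
pose same (s : memory) := [/\ forall j, s 0 j = nth 0 starts j, forall j, s 1 j = nth 0 blocks j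
  & forall j, s 3 j = nth 0 (size vs :: vs) j].
pose I k (s : memory) :=
  [/\ s 5 0 = k, forall j, s 4 j = nth 0 (size (outk k) :: outk k) j & same s].
pose outer_time k := 2 + (\sum_(l < bs (nth 0 vs k)) 4).+1.
apply: runs_le (_ : (\sum_(k < size vs) (outer_time k).+1).+1 <= _) (fun s Qs => Qs) _.
  have -> : size out = \sum_(k < size vs) bs (nth 0 vs k).
    rewrite /out size_flatten /shape -map_comp sumnE big_map (big_nth 0) big_mkord.
    by apply: eq_bigr => k _; rewrite /= size_map size_iota.
  rewrite ltnS mulnDr big_distrr -[X in 4 * X]card_ord -[4 * #|_|]mulnC -sum_nat_const -big_split.
  by apply: leq_sum => k _; rewrite /outer_time sum_nat_const card_ord /=; lia.
apply: (runs_while (I := I) (tm := outer_time)).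
- by do 2?split=> //; move=> j; rewrite /s0 /load /= /outk take0 /=; case: j => [|[|j]].
- move=> k s kn [s5 s4 [s_0 s1 s3]].
  split; first by rewrite /= s3 s5 /=; lia.
  set v := nth 0 vs k.
  apply: runs_put_seq => /=; [lia|rewrite s5; lia|].
  apply: runs_put_seq; rewrite /= ?updateE /= ?s5 ?addn1 ?s3 ?s_0 /= -?/v; [lia|exact: sw|].
  pose J l (s : memory) := [/\ s 5 0 = k.+1, s 6 0 = nth 0 starts v + l,
    forall j, s 4 j = nth 0 (size (outk k ++ block v l) :: (outk k ++ block v l)) j & same s].
  apply: (runs_while (I := J) (tm := fun=> 3)).
  + by split; rewrite /= ?updateE ?addn0 ?cats0.
  + move=> l s' lb [s5' s6' s4' [s_0' s1' s3']].
    have vw : size (outk k) + bs v <= size out.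
      by have := outkw k.+1; rewrite outkS // size_cat size_map size_iota.
    have vs1w := sw v.+1.
    have bE : bs v = nth 0 starts v.+1 - nth 0 starts v by [].
    have lE : size (outk k ++ block v l) = size (outk k) + l by rewrite size_cat size_map size_iota.
    split; first by rewrite /= s5' s6' s3' s_0' /= -/v addn1 -lt0n; lia.
    apply: runs_put_seq; rewrite /= ?s4' //=; first by lia.
      by rewrite lE; lia.
    apply: runs_put_seq; rewrite /= ?updateE /= ?s6' ?s1' ?bw ?lE //; first by lia.
    apply: runs_put; rewrite /= ?updateE /= ?s6' //; [lia|lia|].
    split; rewrite ?updateE //=; first by lia.
      move=> j; rewrite ?updateE /=.
      have -> : block v l.+1 = rcons (block v l) (nth 0 blocks (nth 0 starts v + l)).
        by rewrite /block -addn1 iotaD map_cat cats1.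
      by rewrite -rcons_cat; apply: push_cell => //; rewrite lE addn1.
  + move=> s' [s5' s6' s4' [s_0' s1' s3']]; split; last by split=> //; rewrite outkS.
    by rewrite /= s5' s6' s3' s_0' /= -/v addn1 /bs; lia.
- move=> s [s5 s4 [_ _ s3]]; rewrite /= s3 s5 subnn; split=> // j.
  by rewrite s4 /outk take_size.
Qed.

End TableProgs.

Section TableCodes.
Variables (c : nat) (V : finType) (H : hypergraph V) (W : finType).
Variables (D : splitting H W) (valD : valid_splitting c D).
Implicit Types (u v : V) (w : W).

Local Notation B v := (nodes (tree D v)).
Local Notation L := (incidence_length (split_hypergraph D)).

Lemma ground_bound : #|W| <= L.
Proof. by rewrite /incidence_length -addnA leq_addr. Qed.

Lemma card_vertices : #|V| <= #|W|.
Proof. exact: leq_card (term_distinct valD). Qed.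

Lemma size_le_card (T : finType) (s : seq T) : uniq s -> size s <= #|T|.
Proof. by move=> us; rewrite -(card_uniqP us); apply: max_card. Qed.

Lemma starts_bounded : all (fun x => x <= #|W|) (code_starts D).
Proof.
have <- : \sum_(v <- enum V) size (B v) = #|W| by rewrite big_enum /= (sum_blocks valD).
suff scan vs x : all (fun y => y <= x + \sum_(v <- vs) size (B v))
    (scanl addn x [seq size (B v) | v <- vs]) by exact: scan.
elim: vs x => //= v vs IH x.
by rewrite big_cons addnA leq_addr IH.
Qed.

(** Splitting the enumeration of the vertices at v, the partial sums before and
    after v are the ends of the block of v inside the concatenation. *)
Lemma block_read v :
  block_entries (code_starts D) (code_blocks D) (code_elt v) = [seq code_elt w | w <- B v].
Proof.
rewrite /block_entries.
have [vs1 [vs2 [enumV sv]]] : exists vs1 vs2, enum V = vs1 ++ v :: vs2 /\ size vs1 = code_elt v.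
  exists (take (code_elt v) (enum V)), (drop (code_elt v).+1 (enum V)).
  split; last by rewrite size_takel // -cardE ltnW // code_lt.
  have {2}-> : v = nth v (enum V) (code_elt v) by rewrite -enum_val_nth enum_rankK.
  by rewrite -drop_nth ?cat_take_drop // -cardE code_lt.
have starts_nth x vs vs' : nth 0 (x :: scanl addn x [seq size (B v) | v <- vs ++ vs']) (size vs)
    = x + \sum_(v <- vs) size (B v).
  elim: vs x => [|u vs IH] x /=; first by rewrite big_nil addn0.
  by rewrite IH big_cons addnA.
rewrite -sv.
have -> : nth 0 (code_starts D) (size vs1) = \sum_(v <- vs1) size (B v).
  by rewrite /code_starts enumV starts_nth.
have -> : nth 0 (code_starts D) (size vs1).+1 = \sum_(v <- vs1) size (B v) + size (B v).
  rewrite /code_starts enumV -cat_rcons -(size_rcons vs1 v) starts_nth add0n.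
  by rewrite -cats1 big_cat big_seq1.
rewrite addKn /code_blocks enumV map_cat flatten_cat /=.
set l := flatten _.
have -> : \sum_(v <- vs1) size (B v) = size l.
  rewrite /l size_flatten /shape -map_comp sumnE big_map.
  by apply: eq_bigr => u _; rewrite /= size_map.
apply: (@eq_from_nth _ 0) => [|i]; rewrite !size_map size_iota // => iB.
rewrite (nth_map 0) ?size_iota // nth_iota // nth_cat ltnNge leq_addr /= addKn.
by rewrite nth_cat size_map iB.
Qed.

Lemma terminal_read w : nth 0 (code_terminals D) (code_elt w)
  = if [pick v | term D v == w] is Some v then (code_elt v).+1 else 0.
Proof.
rewrite /code_terminals (nth_map w) -?cardE ?code_lt //.
by rewrite -enum_val_nth enum_rankK.
Qed.

(** Distinct blocks are disjoint, so concatenating them gives a list without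
    repetition whose length is the cost of copying. *)
Lemma hat_computed (S : seq V) : uniq S -> exists S' : seq W,
  [/\ uniq S', [set w in S'] = hat D [set v in S] &
      computes_within (5 * L.+1) (5 * (size S + size S').+1) hat_prog
        (rcons (code_tables D) (code_list S)) [:: code_list S']].
Proof.
move=> uS; pose S' := flatten [seq B v | v <- S].
have uS' : uniq S'.
  rewrite /S' {S'}; elim: S uS => //= v S IH /andP [vS /IH uS'].
  rewrite cat_uniq uS' (nodes_uniq valD) andbT; apply/hasPn => w /flatten_mapP [u uS wu].
  by apply: contraNN vS => wv; rewrite (nodes_disjoint valD wv wu).
exists S'; split=> //.
  apply/setP => w; rewrite inE; apply/flatten_mapP/bigcupP => -[v].
    by move=> vS wv; exists v; rewrite inE.
  by rewrite !inE => vS wv; exists v.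
have WL := ground_bound; have VW := card_vertices.
have S'W := size_le_card uS'; have SV := size_le_card uS.
have readS : flatten [seq block_entries (code_starts D) (code_blocks D) x |
    x <- [seq code_elt v | v <- S]] = [seq code_elt w | w <- S'].
  by rewrite map_flatten -!map_comp; congr flatten; apply: eq_map => v; apply: block_read.
have := @hat_prog_runs (5 * L.+1) (code_starts D) (code_blocks D) (code_terminals D)
  [seq code_elt v | v <- S].
rewrite readS !size_map.
case=> [|||| t [s [ex tb out]]]; [lia|rewrite size_map; lia| | |].
- apply/allP => x /flatten_mapP [v _ /mapP [w _ ->]].
  by have := code_lt w; lia.
- by apply/allP => x /(allP starts_bounded); lia.
rewrite ?size_map in tb; exists t, s; split; [exact: ex|lia|].
by move=> [|k] i // _ _; have := out i; rewrite size_map.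
Qed.

(** Terminals are distinct, so looking them up in a list without repetition
    yields no repetition. *)
Lemma unhat_computed (T : seq W) : uniq T -> exists T' : seq V,
  [/\ uniq T', [set v in T'] = unhat D [set w in T] &
      computes_within (5 * L.+1) (5 * (size T + size T').+1) unhat_prog
        (rcons (code_tables D) (code_list T)) [:: code_list T']].
Proof.
move=> uT; pose T' := pmap (fun w => [pick v | term D v == w]) T.
have mem_T' v : (v \in T') = (term D v \in T).
  rewrite mem_pmap; apply/mapP/idP => [[w wT]|tT].
    by case: pickP => // u /eqP tu [->]; rewrite tu.
  exists (term D v) => //; case: pickP => [u /eqP /(term_distinct valD) -> //|].
  by move=> /(_ v); rewrite eqxx.
have uT' : uniq T'.
  rewrite /T'; apply: (pmap_uniq (g := term D)) uT => w.
  by case: pickP => //= v /eqP.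
exists T'; split=> //; first by apply/setP => v; rewrite !inE.
have WL := ground_bound; have TW := size_le_card uT.
have readT : terminal_owners (code_terminals D) [seq code_elt w | w <- T]
    = [seq code_elt v | v <- T'].
  rewrite /terminal_owners /T' {uT TW T' mem_T' uT'}; elim: T => //= w T IH.
  by rewrite terminal_read; case: pickP => [v _|_] /=; rewrite ?IH.
have := @unhat_prog_runs (5 * L.+1) (code_starts D) (code_blocks D) (code_terminals D)
  [seq code_elt w | w <- T].
rewrite readT !size_map.
case=> [|| t [s [ex tb out]]]; first by lia.
  apply/allP => x /mapP [w _ ->]; case: pickP => // v _.
  have := code_lt v; have := card_vertices; lia.
rewrite ?size_map in tb; exists t, s; split; [exact: ex|lia|].
by move=> [|k] i // _ _; have := out i; rewrite size_map.
Qed.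

End TableCodes.

(** * Trees given by a parent function, and the caterpillar *)

Lemma set2_eqP (T : finType) (x y a b : T) :
  reflect (x = a /\ y = b \/ x = b /\ y = a) ([set x; y] == [set a; b]).
Proof.
apply: (iffP eqP) => [eqxy|[] [-> ->] //]; last exact: setUC.
have /set2P xab : x \in [set a; b] by rewrite -eqxy set21.
have /set2P yab : y \in [set a; b] by rewrite -eqxy set22.
have /set2P axy : a \in [set x; y] by rewrite eqxy set21.
have /set2P bxy : b \in [set x; y] by rewrite eqxy set22.
by case: xab yab axy bxy => [] -> [] -> [] ? [] ?; subst; tauto.
Qed.

Section ParentTree.
Variables (W : finType) (b : nat) (f : nat -> W) (par : nat -> nat).
Hypotheses (b_gt0 : 0 < b) (par_lt : forall j, 0 < j -> par j < j).
Hypothesis f_inj : forall i j, i < b -> j < b -> f i = f j -> i = j.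

(** The tree on nodes 0, ..., b-1, embedded by [f], in which every node j > 0 is
    joined to the smaller node [par j].  The root is 0. *)
Definition parent_tree : graph W :=
  Graph [seq f j | j <- iota 0 b] [seq (f j, f (par j)) | j <- iota 1 b.-1].
Local Notation T := parent_tree.

Definition parent_rel i j := (0 < i) && (j == par i) || (0 < j) && (i == par j).

Lemma mem_parent_tree x : reflect (exists2 j, j < b & x = f j) (x \in nodes T).
Proof.
by apply: (iffP mapP) => - [j jb ->]; exists j; rewrite ?mem_iota ?add0n // in jb *.
Qed.

Lemma mem_nonroot j : (j \in iota 1 b.-1) = (0 < j < b).
Proof. by rewrite mem_iota; case: (b) b_gt0 => // n _; rewrite add1n. Qed.

Lemma parent_adjP x y : reflect
  (exists i j, [/\ i < b, j < b, x = f i, y = f j & parent_rel i j]) (adj T x y).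
Proof.
rewrite /adj /edge_sets -map_comp; apply: (iffP mapP) => /=.
  move=> [k]; rewrite mem_nonroot => /andP [k0 kb] /eqP/set2_eqP; have pk := par_lt k0.
  case=> -[-> ->]; [exists k, (par k)|exists (par k), k];
    by rewrite /parent_rel k0 eqxx ?orbT (ltn_trans pk).
move=> [i [j [ib jb -> -> /orP [] /andP [i0 /eqP E]]]]; [exists i | exists j];
  by rewrite ?mem_nonroot ?ib ?jb ?i0 // E // setUC.
Qed.

Lemma adj_parent i j : i < b -> j < b -> adj T (f i) (f j) = parent_rel i j.
Proof.
move=> ib jb; apply/parent_adjP/idP => [[i' [j' [i'b j'b /f_inj -> // /f_inj -> //]]]|pij].
by exists i, j.
Qed.

Lemma parent_tree_simple : simple T.
Proof.
split.
- by rewrite map_inj_in_uniq ?iota_uniq // => i j; rewrite !mem_iota; apply: f_inj.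
- rewrite /edge_sets -map_comp map_inj_in_uniq ?iota_uniq // => i j.
  rewrite !mem_nonroot => /andP [i0 ib] /andP [j0 jb] /= /eqP/set2_eqP.
  have pi := par_lt i0; have pj := par_lt j0; have pib := ltn_trans pi ib.
  case=> -[]; first by move=> /f_inj ->.
  move=> /(f_inj ib (ltn_trans pj jb)) ipj /(f_inj pib jb) pij.
  by have := par_lt i0; rewrite pij ipj ltnNge ltnW.
- move=> _ /mapP [j + ->] /=; rewrite mem_nonroot => /andP [j0 jb].
  have pj := par_lt j0; have pjb := ltn_trans pj jb.
  split; try by apply/mem_parent_tree; eexists; last by [].
  by apply: contraTneq pj => /(f_inj jb pjb) <-; rewrite ltnn.
Qed.

Lemma adj_sym (G : graph W) : symmetric (adj G).
Proof. by move=> x y; rewrite /adj setUC. Qed.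

Lemma parent_tree_connected : connected T.
Proof.
have root i : i < b -> connect (adj T) (f i) (f 0).
  elim/ltn_ind: i => -[//|i] IH ib.
  have pi := par_lt (ltn0Sn i); have pib := ltn_trans pi ib.
  apply: connect_trans (IH _ pi pib); apply: connect1.
  by rewrite adj_parent // /parent_rel eqxx.
move=> x y /mem_parent_tree [i ib ->] /mem_parent_tree [j jb ->].
apply: connect_trans (root _ ib) _; rewrite (sym_connect_sym (@adj_sym T)); exact: root.
Qed.

(** On a cycle of length at least three, both neighbours of the largest node
    would have to be its parent, although they are distinct. *)
Lemma parent_tree_acyclic : acyclic T.
Proof.
move=> c /andP [cyc unc]; rewrite leqNgt; apply/negP => c2.
pose idx x := index x (nodes T).
have idxf i : i < b -> idx (f i) = i.
  move=> ib; have [un _ _] := parent_tree_simple.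
  have <- : nth (f 0) (nodes T) i = f i by rewrite (nth_map 0) ?size_iota ?nth_iota.
  by rewrite /idx index_uniq ?size_map ?size_iota.
have [x0 x0c] : exists x0, x0 \in c by case: (c) c2 => // x0 s _; exists x0; rewrite mem_head.
(* x is the cycle member of largest index, and y and z are its two neighbours. *)
have [x xc xmax] := @arg_maxnP _ x0 (mem c) idx x0c.
have [k p rc] := rot_to xc.
have mem_c : x :: p =i c by rewrite -rc; apply: mem_rot.
move: cyc unc c2; rewrite -(rot_cycle k) -(rot_uniq k) -(size_rot k) rc.
case: p mem_c {rc} => [//|y p]; case/lastP: p => [//|p z] mem_c.
rewrite /= !rcons_path last_rcons => /and3P [xy _ zx] /and3P [_ + _] _.
rewrite mem_rcons inE => /norP [/eqP yz _]; apply: yz.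
(* By maximality of x, a neighbour of x on the cycle is its parent. *)
have down u : u \in c -> adj T x u -> exists2 i, i < b & x = f i /\ u = f (par i).
  move=> uc /parent_adjP [i [j [ib jb xi uj]]]; rewrite /parent_rel.
  case/orP => /andP [j0 /eqP E]; first by exists i; rewrite // -E.
  have := xmax u uc; rewrite xi uj !idxf // E => le.
  by have := leq_ltn_trans le (par_lt j0); rewrite ltnn.
have [i ib [xi ->]] : exists2 i, i < b & x = f i /\ y = f (par i).
  by apply: down; rewrite // -mem_c !inE eqxx orbT.
have [j jb [xj ->]] : exists2 i, i < b & x = f i /\ z = f (par i).
  by apply: down; rewrite ?(adj_sym _ x) // -mem_c !inE mem_rcons mem_head !orbT.
by congr (f (par _)); apply: f_inj; rewrite -?xi.
Qed.

Lemma parent_treeP : is_tree T.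
Proof.
split; [exact: parent_tree_simple | | exact: parent_tree_connected | exact: parent_tree_acyclic].
by rewrite -size_eq0 size_map size_iota -lt0n.
Qed.

Lemma parent_neighbours i : i < b ->
  [set y | adj T (f i) y] = [set f (val j) | j : 'I_b & parent_rel i j].
Proof.
move=> ib; apply/setP => y; rewrite inE; apply/idP/imsetP => [|[j + ->]].
  move=> /[dup] /parent_adjP [_ [j [_ jb _ -> _]]]; rewrite adj_parent // => ij.
  by exists (Ordinal jb); rewrite ?inE.
by rewrite !inE => pij; rewrite adj_parent //; apply: ltn_ord.
Qed.

Lemma parent_degree i : i < b -> degree T (f i) = count (parent_rel i) (iota 0 b).
Proof.
move=> ib; rewrite /degree parent_neighbours // card_in_imset; last first.
  by move=> j k _ _ /(f_inj (ltn_ord j) (ltn_ord k))/val_inj.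
have -> : iota 0 b = index_iota 0 b by rewrite /index_iota subn0.
rewrite -sum1_card -sum1_count big_mkord.
by apply: eq_bigl => j; rewrite inE.
Qed.

End ParentTree.

(** Truncated subtraction sends 1 to 0.  Further, 2r is sent to 2r-1 and 2r+1
    to 2r-1: the odd nodes form a path starting next to node 0, and every even
    node 2r > 0 hangs from the odd node 2r-1. *)
Definition caterpillar_parent j := j - odd j - 1.

Lemma caterpillar_parent_lt j : 0 < j -> caterpillar_parent j < j.
Proof. by rewrite /caterpillar_parent; lia. Qed.

Section Caterpillar.
Variables (W : finType) (d : nat) (f : nat -> W).
Hypotheses (d_gt1 : 1 < d).
Hypothesis f_inj : forall i j, i < d.*2 -> j < d.*2 -> f i = f j -> i = j.

Local Notation T := (parent_tree d.*2 f caterpillar_parent).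

Lemma caterpillar_rel i j : parent_rel caterpillar_parent i j =
  if i == 0 then j == 1 else if odd i then
    [|| j == caterpillar_parent i, j == i.+1 | j == i.+2] else j == i.-1.
Proof.
have := odd_double_half i; have := odd_double_half j; rewrite /parent_rel /caterpillar_parent.
case: (posnP i) => [->|i0] /=; first by case: (odd j) => /= ji _; apply/idP/idP; lia.
by case: (odd i); case: (odd j) => /= ij ji; apply/idP/idP; lia.
Qed.

Lemma caterpillar_degree i : i < d.*2 ->
  degree T (f i) = count (parent_rel caterpillar_parent i) (iota 0 d.*2).
Proof.
by move=> ib; apply: parent_degree => //; [lia | exact: caterpillar_parent_lt].
Qed.

Lemma caterpillar_degree_le3 : {in nodes T, forall x, degree T x <= 3}.
Proof.
move=> x /mem_parent_tree [i ib ->]; rewrite caterpillar_degree // -size_filter.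
have sub s : (forall j, parent_rel caterpillar_parent i j -> j \in s) ->
    size (filter (parent_rel caterpillar_parent i) (iota 0 d.*2)) <= size s.
  move=> ps; apply: uniq_leq_size; first by rewrite filter_uniq ?iota_uniq.
  by move=> j; rewrite mem_filter => /andP [/ps].
case: (posnP i) => [i0|i0]; last case io : (odd i).
- apply: leq_trans (sub [:: 1] _) _ => // j; rewrite caterpillar_rel i0 inE //.
- apply: (sub [:: caterpillar_parent i; i.+1; i.+2]) => j.
  by rewrite caterpillar_rel io eqn0Ngt i0 !inE.
- apply: leq_trans (sub [:: i.-1] _) _ => // j.
  by rewrite caterpillar_rel io inE eqn0Ngt i0.
Qed.

(** With an even number of nodes, the last one is odd and ends the path; all
    other odd nodes have the next two nodes as children. *)
Lemma caterpillar_leaf i : i < d.*2 ->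
  (degree T (f i) == 1) = ~~ odd i || (i == d.*2.-1).
Proof.
move=> ib; rewrite caterpillar_degree //.
have cnt1 k : k < d.*2 -> (forall j, j < d.*2 -> parent_rel caterpillar_parent i j = (j == k)) ->
    count (parent_rel caterpillar_parent i) (iota 0 d.*2) = 1.
  move=> kb pk; rewrite (eq_in_count (a2 := pred1 k)) ?count_uniq_mem ?iota_uniq ?mem_iota ?kb //.
  by move=> j; rewrite mem_iota; apply: pk.
case: (posnP i) => [i0|i0]; last case io : (odd i) => /=.
- by rewrite (cnt1 1) ?i0 //; [lia | move=> j jb; rewrite caterpillar_rel].
- have [il|il] := eqVneq i d.*2.-1.
    rewrite (cnt1 (caterpillar_parent i)) //; first by rewrite /caterpillar_parent; lia.
    move=> j jb; rewrite caterpillar_rel io eqn0Ngt i0.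
    by case: (j == caterpillar_parent i) => //=; lia.
  apply/eqP => c1; suff : 2 <= 1 by []; rewrite -{2}c1 -size_filter.
  apply: (@uniq_leq_size _ [:: i.+1; i.+2]); first by rewrite /= inE; lia.
  move=> j; rewrite mem_filter caterpillar_rel io eqn0Ngt i0 mem_iota !inE.
  have := odd_double_half i; rewrite io /=.
  by case: (j == caterpillar_parent i) => /= ? ?; lia.
- rewrite (cnt1 i.-1) ?eqxx //; first by lia.
  by move=> j jb; rewrite caterpillar_rel io eqn0Ngt i0.
Qed.

End Caterpillar.

(** * Splitting with caterpillars on consecutive numbers *)

(** 2d for d > 0, and 1 for d = 0: with no occurrence there is only the
    terminal. *)
Definition block_size d := (d.*2.-1).+1.

Definition block_start (g : nat -> nat) k := \sum_(i < k) block_size (g i).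

Section Blocks.
Variable g : nat -> nat.

Lemma block_startS k : block_start g k.+1 = block_start g k + block_size (g k).
Proof. by rewrite /block_start big_ord_recr. Qed.

Lemma block_start_homo : {homo block_start g : k l / k <= l}.
Proof. by apply: homo_leq => // [k l m|k]; [exact: leq_trans | rewrite block_startS leq_addr]. Qed.

Lemma block_bound k n x : k < n -> x < block_size (g k) ->
  block_start g k + x < block_start g n.
Proof.
by move=> kn xk; apply: leq_trans (block_start_homo kn); rewrite block_startS ltn_add2l.
Qed.

Lemma block_inj k l x y : x < block_size (g k) -> y < block_size (g l) ->
  block_start g k + x = block_start g l + y -> k = l /\ x = y.
Proof.
move=> xk yl E; case: (ltngtP k l) => [kl|lk|kl].
- by have := block_bound kl xk; rewrite E ltnNge leq_addr.
- by have := block_bound lk yl; rewrite -E ltnNge leq_addr.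
- by move: E; rewrite kl => /addnI.
Qed.

Lemma block_find n w : w < block_start g n ->
  exists k x, [/\ k < n, x < block_size (g k) & w = block_start g k + x].
Proof.
elim: n => [|n IHn]; first by rewrite /block_start big_ord0.
case: (ltnP w (block_start g n)) => [/IHn [k [x [kn xk ->]]] _|nw]; last first.
  rewrite block_startS -{1}(subnKC nw) ltn_add2l => wn.
  by exists n, (w - block_start g n); split=> //; rewrite subnKC.
by exists k, x; split=> //; apply: ltnW.
Qed.

End Blocks.

(** A repetition of [k] inside one hyperedge does not count. *)
Definition incidences (hs : seq (seq nat)) k := count (fun A => k \in A) hs.

Section Incidences.
Variables (hs : seq (seq nat)) (k : nat).

Lemma incidences_takeS i : i < size hs ->
  incidences (take i.+1 hs) k = incidences (take i hs) k + (k \in nth [::] hs i).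
Proof. by move=> iH; rewrite (take_nth [::]) // /incidences -cats1 count_cat /= addn0. Qed.

Lemma incidences_take_homo : {homo (fun i => incidences (take i hs) k) : i j / i <= j}.
Proof.
apply: homo_leq => // [i j l|i]; first exact: leq_trans.
case: (ltnP i (size hs)) => iH; first by rewrite incidences_takeS ?leq_addr.
by rewrite !take_oversize // ltnW.
Qed.

Lemma incidences_take_lt i j : i < j -> i < size hs -> k \in nth [::] hs i ->
  incidences (take i hs) k < incidences (take j hs) k.
Proof.
move=> ij iH ki; apply: leq_trans (incidences_take_homo ij).
by rewrite incidences_takeS // ki addn1.
Qed.

Lemma incidences_take_inj i j : i < size hs -> j < size hs ->
  k \in nth [::] hs i -> k \in nth [::] hs j ->
  incidences (take i hs) k = incidences (take j hs) k -> i = j.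
Proof.
move=> iH jH ki kj E; case: (ltngtP i j) => // ij.
  by have := incidences_take_lt ij iH ki; rewrite E ltnn.
by have := incidences_take_lt ij jH kj; rewrite E ltnn.
Qed.

(** The running count rises by steps of one, so it takes every value below the
    final one just before some hyperedge containing [k]. *)
Lemma incidences_find r : r < incidences hs k ->
  exists i, [/\ i < size hs, k \in nth [::] hs i & incidences (take i hs) k = r].
Proof.
rewrite -{1}(take_size hs).
elim: {1 3}(size hs) (leqnn (size hs)) => [|m IHm] mH; first by rewrite take0.
rewrite incidences_takeS //.
case: (ltnP r (incidences (take m hs) k)) => [|mr]; first by move=> /(IHm (ltnW mH)).
case km: (k \in _); last by rewrite addn0 ltnNge mr.
by rewrite addn1 ltnS => rm; exists m; split=> //; apply/eqP; rewrite eqn_leq mr.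
Qed.

End Incidences.

Section CaterpillarSplitting.
Variables (V : finType) (H : hypergraph V).
Implicit Types u v : V.

Definition number_lists : seq (seq nat) := [seq [seq code_elt v | v <- A] | A <- H].

Local Notation hs := number_lists.
Local Notation start k := (block_start (incidences hs) k).
Local Notation N := (start #|V|).
Local Notation deg v := (incidences hs (code_elt v)).

Lemma mem_number_lists i v : i < size H ->
  (code_elt v \in nth [::] hs i) = (v \in nth [::] H i).
Proof. by move=> iH; rewrite (nth_map [::]) // mem_map //; apply: code_inj. Qed.

(** The terminal, being the last node of a block, exists for every vertex; it
    witnesses that the ground set is inhabited once there is a vertex. *)
Lemma caterpillar_term_bound v : start (code_elt v) + (block_size (deg v)).-1 < N.
Proof. exact: block_bound (code_lt v) _. Qed.

Definition caterpillar_term v : 'I_N := Ordinal (caterpillar_term_bound v).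

(** The default value only concerns positions past the end of the block, where
    the formula for a junk occurrence may lead. *)
Definition caterpillar_node v j : 'I_N :=
  insubd (caterpillar_term v) (start (code_elt v) + j).

(** The occurrence of v in hyperedge i is number r in its block when r earlier
    hyperedges contain v, and it sits at position 2r. *)
Definition caterpillar_splitting : splitting H 'I_N := {|
  occ := fun v i => caterpillar_node v (incidences (take i hs) (code_elt v)).*2;
  term := caterpillar_term;
  tree := fun v => parent_tree (block_size (deg v)) (caterpillar_node v) caterpillar_parent
|}.
Local Notation D := caterpillar_splitting.

Lemma val_caterpillar_node v j : j < block_size (deg v) ->
  val (caterpillar_node v j) = start (code_elt v) + j.
Proof. by move=> jb; rewrite val_insubd block_bound // code_lt. Qed.

Lemma caterpillar_node_inj u v i j : i < block_size (deg u) -> j < block_size (deg v) ->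
  caterpillar_node u i = caterpillar_node v j -> u = v /\ i = j.
Proof.
move=> iu jv /(congr1 val); rewrite !val_caterpillar_node // => /(block_inj iu jv) [].
by move=> /code_inj.
Qed.

Lemma caterpillar_termE v : caterpillar_term v = caterpillar_node v (block_size (deg v)).-1.
Proof. by apply: val_inj; rewrite val_caterpillar_node. Qed.

Lemma occ_block v r : r < deg v -> r.*2 < block_size (deg v).
Proof. by rewrite /block_size; lia. Qed.

Lemma incidence_block v i : i < size H -> v \in nth [::] H i ->
  incidences (take i hs) (code_elt v) < deg v.
Proof.
move=> iH vi; rewrite -[in X in _ < X](take_size hs).
by apply: incidences_take_lt; rewrite ?size_map ?mem_number_lists.
Qed.

(** The counts of earlier hyperedges, over the hyperedges containing v, range
    over all numbers below the degree of v; so the occurrences occupy exactly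
    the even positions of the block. *)
Lemma caterpillar_occs v :
  occs D v = [set caterpillar_node v (val r).*2 | r : 'I_(deg v)].
Proof.
apply/setP => w; apply/imsetP/imsetP => -[i].
  rewrite inE => vi ->; have ri := incidence_block (ltn_ord i) vi.
  by exists (Ordinal ri).
move=> _ ->; have [j [jH vj jr]] := incidences_find (ltn_ord i).
rewrite size_map in jH; exists (Ordinal jH); last by rewrite /= jr.
by rewrite inE -mem_number_lists.
Qed.

Lemma caterpillar_card_occs v : #|occs D v| = deg v.
Proof.
rewrite caterpillar_occs card_imset ?card_ord // => r r'.
have [rb r'b] := (occ_block (ltn_ord r), occ_block (ltn_ord r')).
by move=> /(caterpillar_node_inj rb r'b) [_ /double_inj/val_inj].
Qed.

(** Distinctness and disjointness reduce to arithmetic, as blocks are disjoint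
    intervals of numbers.  The leaves of the caterpillar are its even nodes,
    where the occurrences are, and its last node, which is the terminal. *)
Lemma caterpillar_valid : valid_splitting 2 D.
Proof.
split.
- move=> u v i j iH jH ui vj /(caterpillar_node_inj (occ_block (incidence_block iH ui))
    (occ_block (incidence_block jH vj))) [uv /double_inj]; subst v.
  by move/incidences_take_inj => -> //; rewrite ?size_map ?mem_number_lists.
- by move=> u v; rewrite /= !caterpillar_termE => /caterpillar_node_inj [].
- move=> u v; rewrite caterpillar_occs /= caterpillar_termE; apply/imsetP => -[r _].
  have rv := occ_block (ltn_ord r); move=> /(caterpillar_node_inj (ltnSn _) rv) [uv].
  by have := ltn_ord r; rewrite uv; rewrite /block_size /=; lia.
- move=> v; rewrite /valid_tree caterpillar_card_occs.
  have inj i j : i < block_size (deg v) -> j < block_size (deg v) ->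
      caterpillar_node v i = caterpillar_node v j -> i = j.
    by move=> ib jb /caterpillar_node_inj [].
  have tE := caterpillar_termE v.
  have oE : occs D v = _ := caterpillar_occs v.
  case E: (deg v) inj tE oE => [|[|d]] inj tE oE.
  + by rewrite /= tE E.
  + have o1 : occs D v = [set caterpillar_node v 0].
      rewrite oE; apply/setP => w; rewrite inE; apply/imsetP/eqP => [[r _ ->]|->];
        last by exists ord0.
      by rewrite ord1.
    rewrite o1 /= E /=; split; rewrite /= ?inE.
    * by rewrite andbT; apply/eqP => /inj => /(_ isT isT).
    * by move=> w; rewrite !inE tE orbC.
    * by rewrite /edge_sets /= tE.
  have bE : block_size d.+2 = d.+2.*2 by rewrite /block_size; lia.
  have -> : tree D v = parent_tree d.+2.*2 (caterpillar_node v) caterpillar_parent.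
    by rewrite -bE -E.
  rewrite bE in inj; split.
  + by apply: parent_treeP; rewrite -?bE //; exact: caterpillar_parent_lt.
  + exact: caterpillar_degree_le3.
  + apply/setP => w; rewrite /leaves in_set in_setU1 -[term D v]/(caterpillar_term v) tE oE bE.
    apply/andP/orP => [[/mem_parent_tree [i ib ->]]|].
      rewrite caterpillar_leaf // => /orP [io|/eqP ->]; last by rewrite eqxx; left.
      right; have rb : i./2 < d.+2 by lia.
      apply/imsetP; exists (Ordinal rb) => //=; congr caterpillar_node.
      by rewrite -{1}[i]odd_double_half (negPf io).
    case=> [/eqP ->|/imsetP [r _ ->]].
      split; first by apply/mem_parent_tree; eexists; last by []; lia.
      by rewrite caterpillar_leaf // ?eqxx ?orbT //; lia.
    have rb := ltn_ord r.
    rewrite -ltn_double in rb; split; first by apply/mem_parent_tree; exists (val r).*2.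
    by rewrite caterpillar_leaf // odd_double.
  + by rewrite size_map size_iota -mul2n.
  + by rewrite size_map size_iota -mul2n leq_pred.
- move=> u v w /mem_parent_tree [i iu ->] /mem_parent_tree [j jv] /caterpillar_node_inj.
  by case.
- move=> w; have [k [x [kV xk wE]]] := block_find (ltn_ord w).
  have [v vk] := code_onto kV; rewrite -vk in xk wE; exists v.
  apply/mem_parent_tree; exists x => //.
  by apply: val_inj; rewrite val_caterpillar_node.
Qed.

End CaterpillarSplitting.

(** * Building the caterpillar splitting in linear time *)

Section Flatten.
Variable f : nat -> seq nat.

Lemma flatten_mkseqS k : flatten (mkseq f k.+1) = flatten (mkseq f k) ++ f k.
Proof. by rewrite mkseqS flatten_rcons. Qed.

Lemma size_flatten_mkseq k : size (flatten (mkseq f k)) = \sum_(i < k) size (f i).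
Proof.
elim: k => [|k IHk]; first by rewrite big_ord0.
by rewrite flatten_mkseqS size_cat IHk big_ord_recr.
Qed.

Lemma size_flatten_mkseq_homo k m : k <= m ->
  size (flatten (mkseq f k)) <= size (flatten (mkseq f m)).
Proof.
elim: m => [|m IHm]; first by rewrite leqn0 => /eqP ->.
rewrite leq_eqVlt => /predU1P [->//|/IHm km].
by rewrite flatten_mkseqS size_cat (leq_trans km) ?leq_addr.
Qed.

Lemma nth_flatten_mkseq m k x : k < m -> x < size (f k) ->
  nth 0 (flatten (mkseq f m)) (size (flatten (mkseq f k)) + x) = nth 0 (f k) x.
Proof.
elim: m => // m IHm km xk; rewrite flatten_mkseqS nth_cat.
have [E|E|E] := ltngtP k m; last first.
- by rewrite E ltnNge leq_addr /= addKn -E.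
- by lia.
rewrite IHm // ifT //; apply: leq_trans (size_flatten_mkseq_homo E).
by rewrite flatten_mkseqS size_cat ltn_add2l.
Qed.

End Flatten.

(** Arrays used by the three phases: 0 is the input, 1 the output hypergraph, 2
    the starts, 3 the blocks, 4 the terminals; 5 counts the hyperedges seen so
    far that contain a given vertex, 6 holds the one-based number of the last
    hyperedge counted for a vertex, and 7 tells for each output cell the vertex
    whose block start is still to be added.  Registers: 8 is the next output
    cell, 9 the number of hyperedges begun, 10 the end of the current hyperedge,
    11 the current vertex, 12 the current node, 13 the parity of its position,
    14 the cell being shifted.

    The copied hyperedges are laid out in the output exactly as the hyperedges
    are in the input, so one register serves as both read and write position.
    Comparing 6 with 9 makes a repeated incidence count once, and the position
    written is then twice the count, minus two. *)
Definition rank_entry : prog :=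
  Put 7 (reg 8) (Get 0 (reg 8)) ;;
  If (Defs.Sub (reg 9) (Get 6 (Get 0 (reg 8))))
    (Put 6 (Get 0 (reg 8)) (reg 9) ;;
     Put 5 (Get 0 (reg 8)) (Add (Get 5 (Get 0 (reg 8))) (Lit 1)))
    Skip ;;
  Put 1 (reg 8) (Defs.Sub (Add (Get 5 (Get 0 (reg 8))) (Get 5 (Get 0 (reg 8)))) (Lit 2)) ;;
  Put 8 (Lit 0) (Add (reg 8) (Lit 1)).

Definition rank_hyperedge : prog :=
  Put 9 (Lit 0) (Add (reg 9) (Lit 1)) ;;
  Put 1 (reg 8) (Get 0 (reg 8)) ;;
  Put 10 (Lit 0) (Add (Add (reg 8) (Lit 1)) (Get 0 (reg 8))) ;;
  Put 8 (Lit 0) (Add (reg 8) (Lit 1)) ;;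
  While (Defs.Sub (reg 10) (reg 8)) rank_entry.

Definition rank_phase : prog :=
  Put 8 (Lit 0) (Lit 2) ;;
  While (Defs.Sub (Get 0 (Lit 1)) (reg 9)) rank_hyperedge.

(** Register 13 toggles and so is the parity of the position of the node in its
    block; the nested truncated subtractions are [caterpillar_parent] at that
    position. *)
Definition layout_edge : prog :=
  Put 12 (Lit 0) (Add (reg 12) (Lit 1)) ;;
  Put 13 (Lit 0) (Defs.Sub (Lit 1) (reg 13)) ;;
  Put 1 (reg 8) (Lit 2) ;;
  Put 1 (Add (reg 8) (Lit 1)) (reg 12) ;;
  Put 1 (Add (reg 8) (Lit 2))
    (Add (Get 2 (reg 11))
       (Defs.Sub (Defs.Sub (Defs.Sub (reg 12) (Get 2 (reg 11))) (reg 13)) (Lit 1))) ;;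
  Put 8 (Lit 0) (Add (reg 8) (Lit 3)).

(** Subtracting 1 from the doubled count and adding it again turns 0 into 1 and
    leaves the other values alone, as for [block_size]. *)
Definition layout_vertex : prog :=
  Put 2 (Add (reg 11) (Lit 1))
    (Add (Add (Get 2 (reg 11))
              (Defs.Sub (Add (Get 5 (reg 11)) (Get 5 (reg 11))) (Lit 1))) (Lit 1)) ;;
  Put 4 (Defs.Sub (Get 2 (Add (reg 11) (Lit 1))) (Lit 1)) (Add (reg 11) (Lit 1)) ;;
  Put 12 (Lit 0) (Get 2 (reg 11)) ;;
  Put 13 (Lit 0) (Lit 0) ;;
  While (Defs.Sub (Get 2 (Add (reg 11) (Lit 1))) (Add (reg 12) (Lit 1))) layout_edge ;;
  Put 11 (Lit 0) (Add (reg 11) (Lit 1)).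

Definition layout_phase : prog :=
  While (Defs.Sub (Get 0 (Lit 0)) (reg 11)) layout_vertex.

(** Cells that need no shift have 0 in array 7, and block 0 starts at 0; so all
    cells can be treated alike.  The blocks are intervals in increasing order,
    so the table of blocks is the identity. *)
Definition shift_cell : prog :=
  Put 1 (reg 14) (Add (Get 1 (reg 14)) (Get 2 (Get 7 (reg 14)))) ;;
  Put 3 (reg 14) (reg 14) ;;
  Put 14 (Lit 0) (Add (reg 14) (Lit 1)).

(** The loop runs through as many cells as the output and the ground set have
    together, which covers both arrays being written; the number of edges is the
    number of nodes minus the number of trees. *)
Definition shift_phase : prog :=
  While (Defs.Sub (Add (reg 8) (Get 2 (Get 0 (Lit 0)))) (reg 14)) shift_cell ;;
  Put 1 (Lit 0) (Get 2 (Get 0 (Lit 0))) ;;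
  Put 1 (Lit 1)
    (Add (Get 0 (Lit 1)) (Defs.Sub (Get 2 (Get 0 (Lit 0))) (Get 0 (Lit 0)))).

Definition split_prog : prog := rank_phase ;; layout_phase ;; shift_phase.

Section Build.
Variables (w n : nat) (hs : seq (seq nat)).
Local Notation m := (size hs).
Local Notation total := (\sum_(A <- hs) size A).
(* The output code takes at most 2 + m + 7 * total cells and the ground set has
   at most n + 2 * total elements; addresses stay below the sum of the two. *)
Hypothesis w_large : 10 * (n + m + total).+1 <= w.
Hypothesis hs_lt : forall i (v : nat), v \in nth [::] hs i -> v < n.

Local Notation g := (incidences hs).
Local Notation start k := (block_start g k).

Definition input := n :: m :: flatten (mkseq (fun i => size (nth [::] hs i) :: nth [::] hs i) m).

(** What the first phase writes for hyperedge [i]: positions relative to the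
    starts, which are not known before the degrees are. *)
Definition rank_list i :=
  size (nth [::] hs i) :: [seq (incidences (take i hs) v).*2 | v <- nth [::] hs i].
(** The cell holding the size of the hyperedge must not be shifted, and gets
    owner 0. *)
Definition owner_list i := 0 :: nth [::] hs i.
Definition occ_list i :=
  size (nth [::] hs i) :: [seq start v + (incidences (take i hs) v).*2 | v <- nth [::] hs i].
Definition edge_lists k l :=
  flatten [seq [:: 2; start k + j; start k + caterpillar_parent j] | j <- iota 1 l].
Definition edge_list k := edge_lists k (block_size (g k)).-1.

Lemma total_nth : total = \sum_(k < m) size (nth [::] hs k).
Proof. by rewrite (big_nth [::]) big_mkord. Qed.

(** Double counting again, for an initial segment of the numbers. *)
Lemma sum_incidences k : \sum_(v < k) g v <= total.
Proof.
rewrite /incidences; elim: hs => [|A hs' IH]; first by rewrite big1.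
rewrite big_split big_cons leq_add //=.
have -> : \sum_(v < k) (val v \in A) = count (fun v => v \in A) (iota 0 k).
  have -> : iota 0 k = index_iota 0 k by rewrite /index_iota subn0.
  by rewrite -sum1_count big_mkord [RHS]big_mkcond; apply: eq_bigr => v _; case: ifP.
rewrite -size_filter; apply: uniq_leq_size; first by rewrite filter_uniq ?iota_uniq.
by move=> v; rewrite mem_filter => /andP [].
Qed.

Lemma start_bound k : start k <= k + 2 * total.
Proof.
have : start k <= k + 2 * \sum_(v < k) g v.
  elim: k => [|k IHk]; first by rewrite /block_start !big_ord0.
  rewrite block_startS big_ord_recr /block_size /=; move: IHk.
  by move: (\sum_(v < k) g v) (g k) => S d; lia.
by move=> le; apply: leq_trans le _; rewrite leq_add2l leq_mul2l sum_incidences orbT.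
Qed.

Lemma start_ge k : k <= start k.
Proof. by elim: k => // k IHk; rewrite block_startS /block_size; lia. Qed.

Local Notation pos k := (size (flatten (mkseq rank_list k))).

Lemma posE k : pos k = k + \sum_(i < k) size (nth [::] hs i).
Proof.
rewrite size_flatten_mkseq; elim: k => [|k IHk]; first by rewrite !big_ord0.
by rewrite !big_ord_recr IHk /= size_map; lia.
Qed.

Lemma pos_owner k : size (flatten (mkseq owner_list k)) = pos k.
Proof. by rewrite !size_flatten_mkseq; apply: eq_bigr => i _; rewrite /= size_map. Qed.

Lemma pos_input k :
  size (flatten (mkseq (fun i => size (nth [::] hs i) :: nth [::] hs i) k)) = pos k.
Proof. by rewrite !size_flatten_mkseq; apply: eq_bigr => i _; rewrite /= size_map. Qed.

Lemma pos_bound k : k < m -> pos k + size (nth [::] hs k) < m + total.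
Proof.
move=> km; have := size_flatten_mkseq_homo rank_list km.
by rewrite flatten_mkseqS size_cat [X in _ <= X -> _]posE -total_nth /= size_map; lia.
Qed.

Lemma input_nth k x : k < m -> x <= size (nth [::] hs k) ->
  nth 0 input (pos k + x).+2 = nth 0 (size (nth [::] hs k) :: nth [::] hs k) x.
Proof. by move=> km xk; rewrite -pos_input /= nth_flatten_mkseq. Qed.

(** State after [k] hyperedges. *)
Definition rank_spec k (s : memory) :=
  [/\ [/\ forall j, s 0 j = nth 0 input j,
          forall j, s 1 j = nth 0 [:: 0, 0 & flatten (mkseq rank_list k)] j &
          forall j, s 7 j = nth 0 [:: 0, 0 & flatten (mkseq owner_list k)] j],
      s 8 0 = (pos k).+2, forall v, s 5 v = incidences (take k hs) v &
      clear [:: 2; 4; 11; 14] s].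

(** State inside hyperedge [k], after [l] of its entries: the counts include
    hyperedge [k] just for the vertices among these entries, which are those
    marked with the number [k.+1]. *)
Definition rank_entry_spec k l (s : memory) :=
  let A := nth [::] hs k in
  [/\ [/\ forall j, s 0 j = nth 0 input j,
          forall j, s 1 j = nth 0 ([:: 0, 0 & flatten (mkseq rank_list k)] ++
            size A :: [seq (incidences (take k hs) v).*2 | v <- take l A]) j &
          forall j, s 7 j = nth 0 ([:: 0, 0 & flatten (mkseq owner_list k)] ++
            0 :: take l A) j],
      [/\ s 8 0 = (pos k + l).+3, s 9 0 = k.+1 & s 10 0 = (pos k + size A).+3],
      forall v, s 5 v = incidences (take k hs) v + (v \in take l A),
      forall v, s 6 v <= k.+1 /\ (s 6 v == k.+1) = (v \in take l A) &
      clear [:: 2; 4; 11; 14] s].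

Lemma rank_entry_runs k l s : k < m -> l < size (nth [::] hs k) ->
  rank_entry_spec k l s -> runs w rank_entry s 6 (rank_entry_spec k l.+1).
Proof.
move=> km; rewrite /rank_entry_spec; have posk := pos_bound km.
have := @hs_lt k; have := @input_nth k ^~ km.
set A := nth [::] hs k in posk *; move=> inA Alt lA.
have vn := Alt _ (mem_nth 0 lA).
have in_v : nth 0 input (pos k + l).+3 = nth 0 A l by have := inA l.+1 lA; rewrite addnS.
have takeS : take l.+1 A = rcons (take l A) (nth 0 A l) by rewrite (take_nth 0).
have take_l : size (take l A) = l by rewrite size_takel // ltnW.
set v := nth 0 A l in vn in_v takeS.
have vb : incidences (take k hs) v <= m.
  by rewrite (leq_trans (count_size _ _)) // size_take_min geq_minr.
move=> [[s0 s1 s7] [s8 s9 s10] s5 s6 sz].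
apply: runs_put_seq; rewrite /= ?s8 ?s0 ?in_v; [lia|lia|].
pose M (s : memory) :=
  [/\ [/\ forall j, s 0 j = nth 0 input j,
          forall j, s 1 j = nth 0 ([:: 0, 0 & flatten (mkseq rank_list k)] ++
            size A :: [seq (incidences (take k hs) v).*2 | v <- take l A]) j &
          forall j, s 7 j = nth 0 ([:: 0, 0 & flatten (mkseq owner_list k)] ++
            0 :: take l.+1 A) j],
      [/\ s 8 0 = (pos k + l).+3, s 9 0 = k.+1 & s 10 0 = (pos k + size A).+3],
      forall v, s 5 v = incidences (take k hs) v + (v \in take l.+1 A),
      forall v, s 6 v <= k.+1 /\ (s 6 v == k.+1) = (v \in take l.+1 A) &
      clear [:: 2; 4; 11; 14] s].
apply: (runs_seq (t := 3) (t' := 2)); apply: (runs_le (Q := M) (leqnn _)).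
  move=> s' [[s0' s1' s7'] [s8' s9' s10'] s5' s6' sz'].
  have s5v : s' 5 v + s' 5 v - 2 = (incidences (take k hs) v).*2.
    by rewrite s5' takeS mem_rcons inE eqxx addn1; lia.
  apply: runs_put_seq; rewrite /= ?s8' ?s0' ?in_v ?s5v; [lia|lia|].
  apply: runs_put; rewrite /= ?updateE /= ?s8'; [lia|lia|].
  split; [split|split| | |]; frame.
  - move=> j; rewrite ?updateE /= takeS map_rcons -rcons_cons -!rcons_cat -rcons_cons.
    by apply: (append_cell _ s1'); rewrite /= size_cat /= size_map take_l; lia.
  - by rewrite ?updateE /=; lia.
  - by do 2!apply: clear_update => //.
have s7' j : (if j == (pos k + l).+3 then v else s 7 j)
    = nth 0 ([:: 0, 0 & flatten (mkseq owner_list k)] ++ 0 :: take l.+1 A) j.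
  rewrite takeS -rcons_cons -rcons_cat; apply: (append_cell _ s7).
  by rewrite /= size_cat pos_owner /= take_l; lia.
have [s6v s6e] := s6 v.
apply: runs_if; rewrite /= ?updateE /= s9 s8 s0 in_v => marked.
  (* First occurrence of v in this hyperedge: it gets marked and counted. *)
  have vl : (v \in take l A) = false by rewrite -s6e; lia.
  apply: runs_put_seq; rewrite /= ?updateE /= ?s8 ?s0 ?in_v ?s9; [lia|lia|].
  apply: runs_put; rewrite /= ?updateE /= ?s8 ?s0 ?in_v ?s5 ?vl; [lia|lia|].
  split; [split|split| | |]; frame.
  - move=> u; rewrite ?updateE /= takeS mem_rcons inE.
    by case: eqP => [->|_] /=; rewrite ?addn0 ?addn1 ?s5.
  - move=> u; rewrite ?updateE /= takeS mem_rcons inE.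
    by case: eqP => [->|_] //=; rewrite eqxx.
  - by do 3!apply: clear_update => //.
(* Repeated incidence: already marked, so the count stays. *)
have vl : v \in take l A by rewrite -s6e; lia.
have mem_l u : (u \in take l.+1 A) = (u \in take l A).
  by rewrite takeS mem_rcons inE; case: eqP => // ->; rewrite vl.
apply: runs_skip; split; [split|split| | |]; frame.
- by move=> u; rewrite ?updateE /= mem_l.
- by move=> u; rewrite ?updateE /= mem_l.
- by do 1!apply: clear_update => //.
Qed.

Lemma rank_hyperedge_runs k s : k < m ->
  rank_spec k s -> s 9 0 = k -> (forall v, s 6 v <= k) ->
  runs w rank_hyperedge s (5 + 7 * size (nth [::] hs k))
    (fun s' => [/\ rank_spec k.+1 s', s' 9 0 = k.+1 & forall v, s' 6 v <= k.+1]).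
Proof.
move=> km [[s0 s1 s7] s8 s5 sz] s9 s6; have posk := pos_bound km.
have totk : size (nth [::] hs k) <= total.
  by rewrite total_nth (bigD1 (Ordinal km)) //= leq_addr.
have in_size : nth 0 input (pos k).+2 = size (nth [::] hs k).
  by rewrite -[pos k]addn0 input_nth.
have -> : 5 + 7 * size (nth [::] hs k) = 4 + (\sum_(l < size (nth [::] hs k)) 7).+1.
  by rewrite sum_nat_const card_ord; lia.
apply: runs_put_seq; rewrite /= ?s9; [lia|lia|].
do 3!(apply: runs_put_seq; rewrite /= ?updateE /= ?s8 ?s0 ?in_size; [lia|lia|]).
apply: (runs_while (I := rank_entry_spec k) (tm := fun=> 6)).
- split; [split|split| | |]; rewrite ?take0 ?updateE //=.
  + move=> j; rewrite ?updateE /= -!cat_cons cats1.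
    by apply: (append_cell _ s1).
  + by move=> j; rewrite ?updateE /= (s7 j) -!cat_cons -(nth_pad _ 1).
  + by lia.
  + by lia.
  + by lia.
  + by move=> v; rewrite ?updateE /= s5 addn0.
  + by move=> v; rewrite ?updateE /= leqW ?s6 // ltn_eqF // ltnS.
  + by do 4!apply: clear_update => //.
- move=> l s2 lA sp; split; last exact: rank_entry_runs.
  by case: sp => _ [s8' _ s10'] _ _ _; rewrite /= s8' s10'; lia.
- move=> s2 [[s0' s1' s7'] [s8' s9' s10'] s5' s6' sz'].
  split; first by rewrite /= s8' s10' subnn.
  rewrite take_size in s1' s7' s5' s6'; split=> //; last by move=> v; case: (s6' v).
  split=> //; first split=> //.
  + by move=> j; rewrite s1' flatten_mkseqS.
  + by move=> j; rewrite s7' flatten_mkseqS.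
  + by rewrite s8' flatten_mkseqS size_cat /= size_map; lia.
  + by move=> v; rewrite s5' incidences_takeS.
Qed.

Lemma rank_phase_runs s :
  (forall j, s 0 j = nth 0 input j) -> (forall a j, a != 0 -> s a j = 0) ->
  runs w rank_phase s (2 + 6 * m + 7 * total) (rank_spec m).
Proof.
move=> s_in s_zero.
apply: (runs_le (t := 1 + (\sum_(k < m) (5 + 7 * size (nth [::] hs k)).+1).+1) _ (fun _ Qs => Qs)).
  rewrite (eq_bigr (fun k : 'I_m => 6 + 7 * size (nth [::] hs k))) //.
  by rewrite big_split sum_nat_const card_ord -big_distrr -total_nth /=; lia.
apply: runs_put_seq => /=; [lia|lia|].
pose I k s' := [/\ rank_spec k s', s' 9 0 = k & forall v, s' 6 v <= k].
apply: (runs_while (I := I) (tm := fun k => 5 + 7 * size (nth [::] hs k))).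
- split; [split; first split| |] => //; try by move=> *; rewrite updateE /= ?s_in ?s_zero ?take0.
  + by move=> j; rewrite updateE /= s_zero //; case: j => [|[|[|j]]].
  + by move=> j; rewrite updateE /= s_zero //; case: j => [|[|[|j]]].
  + by apply: clear_update => // a j; rewrite !inE => /or4P [] /eqP ->; apply: s_zero.
- move=> k s' km [sp s9 s6]; split; last exact: rank_hyperedge_runs.
  by have [[s0 _ _] _ _ _] := sp; rewrite /= s0 s9 /=; lia.
- move=> s' [sp s9 _]; split=> //; have [[s0 _ _] _ _ _] := sp.
  by rewrite /= s0 s9 /= subnn.
Qed.



Local Notation bs k := (block_size (g k)).
Local Notation ranks := [:: 0, 0 & flatten (mkseq rank_list m)].
Local Notation owners := [:: 0, 0 & flatten (mkseq owner_list m)].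
Local Notation edges_before k := (flatten (mkseq edge_list k)).

Definition starts_spec k (s : memory) := forall j, s 2 j = nth 0 (mkseq (block_start g) k) j.

(** The blocks are filled in order, so the cells from the next start on are still
    zero. *)
Definition terms_spec k (s : memory) :=
  (forall i x, i < k -> x < bs i -> s 4 (start i + x) = if x == (bs i).-1 then i.+1 else 0)
  /\ forall j, start k <= j -> s 4 j = 0.

(** State after [k] vertices. *)
Definition layout_spec k (s : memory) :=
  [/\ [/\ forall j, s 0 j = nth 0 input j,
          forall j, s 1 j = nth 0 (ranks ++ edges_before k) j &
          forall j, s 7 j = nth 0 owners j],
      s 8 0 = (pos m + size (edges_before k)).+2, forall v, s 5 v = g v,
      starts_spec k.+1 s /\ terms_spec k s &
      s 11 0 = k /\ s 14 0 = 0].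

(** State inside the block of [k], after [l] of its edges; the start of the next
    block and the terminal of [k] are already in place. *)
Definition layout_edge_spec k l (s : memory) :=
  [/\ [/\ forall j, s 0 j = nth 0 input j,
          forall j, s 1 j = nth 0 (ranks ++ edges_before k ++ edge_lists k l) j &
          forall j, s 7 j = nth 0 owners j],
      s 8 0 = (pos m + size (edges_before k) + 3 * l).+2, forall v, s 5 v = g v,
      starts_spec k.+2 s /\ terms_spec k.+1 s &
      [/\ s 11 0 = k, s 14 0 = 0, s 12 0 = start k + l & s 13 0 = odd l]].

Lemma size_edge_lists k l : size (edge_lists k l) = 3 * l.
Proof.
rewrite /edge_lists size_flatten /shape -map_comp.
rewrite (@eq_map _ _ _ (fun=> 3)) // sumnE big_map big_const_seq.
by rewrite count_predT size_iota iter_addn_0.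
Qed.

Lemma edge_listsS k l : edge_lists k l.+1 = edge_lists k l ++
  [:: 2; start k + l.+1; start k + caterpillar_parent l.+1].
Proof. by rewrite /edge_lists -{1}[l.+1]addn1 iotaD map_cat flatten_cat /= add1n. Qed.

(** A block is a tree, so it has one edge less than nodes, and an edge takes
    three cells. *)
Lemma size_edges_before k : size (edges_before k) + 3 * k = 3 * start k.
Proof.
elim: k => [|k IHk]; first by rewrite /block_start big_ord0.
by rewrite flatten_mkseqS size_cat size_edge_lists block_startS /block_size /=; lia.
Qed.

Lemma starts_nth k i (s : memory) : starts_spec k s -> i < k -> s 2 i = start i.
Proof. by move=> -> ik; rewrite nth_mkseq. Qed.

Lemma layout_bound k : k < n ->
  [/\ start k.+1 = start k + bs k, start k.+1 <= n + 2 * total,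
      size (edges_before k) + 3 * (bs k).-1 <= 6 * total & pos m = m + total].
Proof.
move=> kn; have := start_bound n; have := block_start_homo g kn.
have := size_edges_before k.+1; have := size_edges_before n.
have := size_flatten_mkseq_homo edge_list kn.
rewrite {1 2}flatten_mkseqS size_cat size_edge_lists posE -total_nth block_startS.
by move=> *; split=> //; lia.
Qed.

Lemma layout_edge_runs k l s : k < n -> l < (bs k).-1 ->
  layout_edge_spec k l s -> runs w layout_edge s 6 (layout_edge_spec k l.+1).
Proof.
move=> kn lb; have [startS startB edgesB posM] := layout_bound kn.
have bk : (bs k).-1 < bs k by [].
move=> [[s0 s1 s7] s8 s5 [sst ster] [s11 s14 s12 s13]].
have s2k : s 2 k = start k by apply: starts_nth sst _.
(* Register 13 holds the parity of the position reached. *)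
have podd : 1 - odd l = odd l.+1 by rewrite /=; case: (odd l).
have par : start k + l.+1 - start k - odd l.+1 - 1 = caterpillar_parent l.+1.
  by rewrite addKn.
have parlt := caterpillar_parent_lt (ltn0Sn l).
do 6!(first [apply: runs_put_seq | apply: runs_put];
  rewrite /= ?updateE /= ?s12 ?s13 ?s8 ?s11 ?s2k ?addn1 -?addnS ?podd ?par; [lia|lia|]).
split; [split|..]; frame.
(* Three cells are appended: the size, the node, its parent. *)
- move=> j; rewrite ?updateE /= edge_listsS !catA -!cat_rcons cats0.
  rewrite -catA.
  set L := ranks ++ _ in s1 *.
  have sL : size L = (pos m + size (edges_before k) + 3 * l).+2.
    by rewrite /L /= !size_cat size_edge_lists; lia.
  by apply: (append_cell _ (append_cell _ (append_cell _ s1 _) _) _); rewrite ?size_rcons sL; lia.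
- by rewrite ?updateE /=; lia.
- by split.
Qed.

Lemma layout_vertex_runs k s : k < n ->
  layout_spec k s -> runs w layout_vertex s (6 + 7 * (bs k).-1) (layout_spec k.+1).
Proof.
move=> kn; have [startS startB edgesB posM] := layout_bound kn.
move=> [[s0 s1 s7] s8 s5 [sst [ster sfree]] [s11 s14]].
have s2k : s 2 k = start k by apply: starts_nth sst _.
have -> : 6 + 7 * (bs k).-1 = 4 + ((\sum_(l < (bs k).-1) 7).+1 + 1).
  by rewrite sum_nat_const card_ord; lia.
(* The program computes the block size without a maximum. *)
have startE : start k + (g k + g k - 1) + 1 = start k.+1 by rewrite startS /block_size; lia.
have le_start := start_ge k.
have lt_start : start k < start k.+1 by rewrite startS /block_size; lia.
do 4!(apply: runs_put_seq;
  rewrite /= ?updateE /= ?s11 ?s2k ?s5 ?startE ?addn1 ?eqxx ?(ltn_eqF (ltnSn k)) /= ?s2k;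
  [lia|lia|]).
rewrite -[X in runs _ _ _ X]addn1; apply: runs_seq.
apply: (runs_while (I := layout_edge_spec k) (tm := fun=> 6)).
- split; [split|..]; frame.
  + by move=> j; rewrite ?updateE /= cats0.
  + by rewrite ?updateE /= s8; lia.
  + have s2' j : (if j == k.+1 then start k.+1 else s 2 j) = nth 0 (mkseq (block_start g) k.+2) j.
      by rewrite mkseqS; apply: (append_cell _ sst); rewrite size_mkseq.
    split; first by move=> j; rewrite ?updateE /= s2'.
    split=> [i x ik xb|j kj]; rewrite ?updateE /=; last first.
      by rewrite (gtn_eqF (_ : start k.+1 - 1 < j)) ?sfree; lia.
    case: (ltngtP i k) => ik'; [|by lia|].
      have := block_bound ik' xb => ?.
      by rewrite (ltn_eqF (_ : _ < start k.+1 - 1)) ?ster //; lia.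
    subst i; rewrite startS -addnBA // eqn_add2l subn1.
    by case: eqP => // _; rewrite sfree // leq_addr.
  + by split; rewrite ?updateE /= ?addn0.
- move=> l s2 lb sp; split; last exact: layout_edge_runs.
  case: sp => [_ _ _ [sst' _] [s11' _ s12' _]].
  by rewrite /= s11' s12' addn1 (starts_nth sst') // startS /block_size /= in lb *; lia.
- move=> s2 [[s0' s1' s7'] s8' s5' [sst' ster'] [s11' s14' s12' s13']]; split.
    by rewrite /= s11' s12' addn1 (starts_nth sst') // startS /block_size /=; lia.
  apply: runs_put; rewrite /= ?s11'; [lia|lia|].
  split; [split|..]; frame.
  + by move=> j; rewrite flatten_mkseqS; apply: s1'.
  + by rewrite flatten_mkseqS size_cat size_edge_lists ?updateE /= s8'; lia.
  + by split; rewrite ?updateE /= ?addn1.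
Qed.

Lemma layout_phase_runs s : rank_spec m s ->
  runs w layout_phase s (1 + 7 * start n) (layout_spec n).
Proof.
move=> [[s0 s1 s7] s8 s5 sz].
have -> : 1 + 7 * start n = (\sum_(k < n) (6 + 7 * (bs k).-1).+1).+1.
  rewrite add1n /block_start big_distrr; congr _.+1; apply: eq_bigr => k _.
  by rewrite /block_size /=; lia.
apply: (runs_while (I := layout_spec) (tm := fun k => 6 + 7 * (bs k).-1)).
- split; [split|..]; frame.
  + by move=> j; rewrite s1 cats0.
  + by rewrite s8 addn0.
  + by move=> v; rewrite s5 take_size.
  + split; last by split=> // j _; rewrite sz.
    by move=> j; rewrite sz // /mkseq /= /block_start big_ord0; case: j => [|[|j]].
- move=> k s' kn sp; split; last exact: layout_vertex_runs.
  by case: sp => [[s0' _ _] _ _ _ [s11 _]]; rewrite /= s0' s11 /=; lia.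
- move=> s' sp; split=> //.
  by case: sp => [[s0' _ _] _ _ _ [s11 _]]; rewrite /= s0' s11 /= subnn.
Qed.

Definition split_body : seq nat :=
  flatten (mkseq occ_list m) ++ edges_before n.

Definition built_spec (s : memory) :=
  [/\ forall j, s 1 j = nth 0 [:: start n, m + (start n - n) & split_body] j,
      starts_spec n.+1 s, forall j, j < start n -> s 3 j = j & terms_spec n s].

Definition shift_spec k (s : memory) :=
  [/\ [/\ forall j, s 0 j = nth 0 input j,
          forall j, s 1 j = nth 0 (ranks ++ edges_before n) j
                      + (if j < k then nth 0 (mkseq (block_start g) n.+1) (nth 0 owners j) else 0) &
          forall j, s 7 j = nth 0 owners j],
      s 8 0 = (pos m + size (edges_before n)).+2,
      forall j, j < k -> s 3 j = j,
      starts_spec n.+1 s /\ terms_spec n s & s 14 0 = k].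

Lemma start0 : start 0 = 0.
Proof. by rewrite /block_start big_ord0. Qed.

Lemma shifted_ranks k j : k <= m ->
  nth 0 (flatten (mkseq rank_list k)) j
    + nth 0 (mkseq (block_start g) n.+1) (nth 0 (flatten (mkseq owner_list k)) j)
  = nth 0 (flatten (mkseq occ_list k)) j.
Proof.
have size_occ i : size (flatten (mkseq occ_list i)) = pos i.
  by rewrite !size_flatten_mkseq; apply: eq_bigr => l _; rewrite /= !size_map.
have nth_start v : v <= n -> nth 0 (mkseq (block_start g) n.+1) v = start v.
  by move=> vn; rewrite nth_mkseq.
move: (mkseq _ _) nth_start => S nth_start.
elim: k => [|k IHk] km; first by rewrite !nth_nil nth_start ?start0.
rewrite !flatten_mkseqS !nth_cat pos_owner size_occ.
case: ltnP => kj; first exact: IHk (ltnW km).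
case: (j - pos k) => [|l] /=; first by rewrite nth_start // start0 addn0.
case: (ltnP l (size (nth [::] hs k))) => lA; last first.
  by rewrite (nth_default 0 lA) nth_start // start0 addn0 !(@nth_default nat 0) ?size_map.
rewrite !(nth_map 0) // addnC nth_start // ltnW //.
exact: hs_lt (mem_nth 0 lA).
Qed.

(** Past the copied hyperedges the list of owners ends, its default value is 0,
    and block 0 starts at 0. *)
Lemma shifted_body j :
  nth 0 (ranks ++ edges_before n) j + nth 0 (mkseq (block_start g) n.+1) (nth 0 owners j)
  = nth 0 [:: 0, 0 & split_body] j.
Proof.
have size_occ : size (flatten (mkseq occ_list m)) = pos m.
  by rewrite !size_flatten_mkseq; apply: eq_bigr => l _; rewrite /= !size_map.
have nth_start0 : nth 0 (mkseq (block_start g) n.+1) 0 = 0 by rewrite nth_mkseq ?start0.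
set S := mkseq _ n.+1 in nth_start0 *; case: j => [|[|j]] //=.
rewrite /split_body !nth_cat size_occ.
case: ltnP => jm; first exact: shifted_ranks.
by rewrite (@nth_default _ 0 (flatten (mkseq owner_list _))) ?pos_owner // nth_start0 addn0.
Qed.

Lemma split_body_lt j : nth 0 [:: 0, 0 & split_body] j < w.
Proof.
suff bodyw : {in split_body, forall x, x < w}.
  case: j => [|[|j]] /=; [lia|lia|].
  by case: (ltnP j (size split_body)) => [/(mem_nth 0)/bodyw|/(nth_default 0) ->] //; lia.
have startB := start_bound n.
move=> x; rewrite mem_cat => /orP [] /flatten_mapP [i]; rewrite mem_iota add0n => /andP [_ im].
  have Ai : size (nth [::] hs i) <= total by rewrite total_nth (bigD1 (Ordinal im)) //= leq_addr.
  rewrite inE => /predU1P [->|/mapP [v vA ->]]; first by lia.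
  have := start_bound v; have := hs_lt vA.
  have : incidences (take i hs) v <= m.
    by rewrite (leq_trans (count_size _ _)) // size_take_min geq_minr.
  by rewrite -mul2n; lia.
move=> /flatten_mapP [j']; rewrite mem_iota add1n => /andP [j0 jb].
have := block_bound im (jb : j' < bs i); have := caterpillar_parent_lt j0.
by rewrite !inE => ? ? /or3P [] /eqP ->; lia.
Qed.

Lemma shift_phase_runs s : layout_spec n s ->
  runs w shift_phase s (1 + 4 * ((pos m + size (edges_before n)).+2 + start n) + 2) built_spec.
Proof.
move=> [[s0 s1 s7] s8 s5 [sst ster] [_ s14]].
have startB := start_bound n; have edgesB := size_edges_before n.
have posM : pos m = m + total by rewrite posE -total_nth.
have s2n (s' : memory) : starts_spec n.+1 s' -> s' 2 n = start n by move=> /starts_nth ->.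
set P := (pos m + size (edges_before n)).+2.
have -> : 1 + 4 * (P + start n) = (\sum_(k < P + start n) 4).+1.
  by rewrite sum_nat_const card_ord mulnC.
apply: runs_seq; apply: (runs_while (I := shift_spec) (tm := fun=> 3)).
- split; [split|..]; frame; last by [].
  by move=> j; rewrite addn0.
- move=> k s' kP [[s0' s1' s7'] s8' s3' [sst' ster'] s14'].
  split; first by rewrite /= s8' s0' /= s2n // s14' -/P; lia.
  have valB : s' 1 k + s' 2 (s' 7 k) < w.
    rewrite s1' ltnn addn0 sst' s7' shifted_body.
    exact: split_body_lt.
  do 3!(first [apply: runs_put_seq | apply: runs_put];
    rewrite /= ?updateE /= ?s14' /=; [lia|lia|]).
  split; [split|..]; frame.
  + move=> j; rewrite ?updateE /= !s1' s7' sst' ltnn addn0 ltnS [j <= k]leq_eqVlt.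
    by have [->|_] := eqVneq j k.
  + move=> j; rewrite ?updateE /= ltnS leq_eqVlt.
    by case: eqP => // _ /= /s3'.
  + by rewrite ?updateE /= addn1.
- move=> s' [[s0' s1' s7'] s8' s3' [sst' ster'] s14'].
  split; first by rewrite /= s8' s0' /= s2n // s14' -/P subnn.
  have body j : s' 1 j = nth 0 [:: 0, 0 & split_body] j.
    rewrite s1' -shifted_body; congr (_ + _); case: ltnP => // Pj.
    rewrite (nth_default 0 (s := owners)) ?nth_mkseq ?start0 //.
    by rewrite /= pos_owner; lia.
  do 2!(first [apply: runs_put_seq | apply: runs_put];
    rewrite /= ?updateE /= ?s0' /= ?s2n //; [lia|lia|]).
  split; frame.
  + by move=> j; rewrite ?updateE /= body; case: j => [|[|j]].
  + by move=> j jn; rewrite ?updateE /= s3' // ltn_addl.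
Qed.

Lemma split_prog_runs s :
  (forall j, s 0 j = nth 0 input j) -> (forall a j, a != 0 -> s a j = 0) ->
  runs w split_prog s (100 * (n + m + total).+1) built_spec.
Proof.
move=> s_in s_zero.
apply: (runs_le (t := (2 + 6 * m + 7 * total) + ((1 + 7 * start n) +
  (1 + 4 * ((pos m + size (edges_before n)).+2 + start n) + 2))) _ (fun _ Qs => Qs)).
  have startB := start_bound n; have edgesB := size_edges_before n.
  have posM : pos m = m + total by rewrite posE -total_nth.
  lia.
apply: runs_seq; apply: runs_le (leqnn _) _ (rank_phase_runs s_in s_zero) => s1 sp1.
apply: runs_seq; apply: runs_le (leqnn _) _ (layout_phase_runs sp1) => s2 sp2.
exact: shift_phase_runs.
Qed.

End Build.

(** * The build program writes the code of the caterpillar splitting *)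

Section CaterpillarCodes.
Variables (V : finType) (H : hypergraph V).
Implicit Types u v : V.

Local Notation hs := (number_lists H).
Local Notation start k := (block_start (incidences hs) k).
Local Notation N := (start #|V|).
Local Notation deg v := (incidences hs (code_elt v)).
Local Notation D := (caterpillar_splitting H).

Lemma number_lists_lt i x : x \in nth [::] hs i -> x < #|V|.
Proof.
case: (ltnP i (size H)) => iH; last by rewrite nth_default // size_map.
by rewrite (nth_map [::]) // => /mapP [v _ ->]; apply: code_lt.
Qed.

Lemma total_number_lists : \sum_(A <- hs) size A = \sum_(A <- H) size A.
Proof. by rewrite big_map; apply: eq_bigr => A _; rewrite size_map. Qed.

Lemma code_input : code_hypergraph H = input #|V| hs.
Proof.
rewrite /code_hypergraph /input size_map; congr [:: _, _ & flatten _].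
apply: (@eq_from_nth _ [::]) => [|i]; rewrite ?size_map ?size_iota // => iH.
by rewrite nth_mkseq // !(nth_map [::]) // /code_list size_map.
Qed.

Lemma code_node v j : j < block_size (deg v) ->
  code_elt (caterpillar_node H v j) = start (code_elt v) + j.
Proof. by move=> jb; rewrite code_ord; apply: val_caterpillar_node. Qed.

Lemma code_tree_edges v :
  flatten [seq code_list A | A <- [seq [:: e.1; e.2] | e <- edges (tree D v)]]
  = edge_list hs (code_elt v).
Proof.
rewrite /= -!map_comp /edge_list /edge_lists; congr flatten; apply/eq_in_map => j.
rewrite mem_iota add1n => /andP [j0 jb] /=; have pj := caterpillar_parent_lt j0.
by rewrite /code_list /= !code_node // (ltn_trans pj).
Qed.

Lemma code_split_body :
  flatten [seq code_list A | A <- split_hypergraph D] = split_body #|V| hs.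
Proof.
rewrite /split_hypergraph /split_body map_cat flatten_cat size_map; congr (_ ++ _).
  congr flatten; rewrite -map_comp; apply/eq_in_map => i; rewrite mem_iota add0n => /andP [_ iH].
  rewrite /= /code_list /occ_list size_map (nth_map [::]) // size_map; congr cons.
  rewrite -!map_comp; apply/eq_in_map => v vi /=.
  by rewrite code_node // occ_block // incidence_block.
rewrite -map_code_enum; elim: (enum V) => //= v vs IH.
by rewrite map_cat flatten_cat IH code_tree_edges.
Qed.

Lemma size_split : size (split_hypergraph D) = size hs + (N - #|V|).
Proof.
rewrite size_cat size_mkseq size_map; congr (_ + _).
have -> : size (flatten [seq [seq [:: e.1; e.2] | e <- edges (tree D v)] | v <- enum V])
    = \sum_(k < #|V|) (block_size (incidences hs k)).-1.
  rewrite size_flatten /shape -map_comp sumnE big_map.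
  rewrite -(big_mkord predT (fun k => (block_size (incidences hs k)).-1)).
  rewrite /index_iota subn0 -code_enum big_map; apply: eq_bigr => v _.
  by rewrite /= !size_map size_iota.
have -> : N = \sum_(k < #|V|) ((block_size (incidences hs k)).-1 + 1).
  by apply: eq_bigr => k _; rewrite addn1.
by rewrite big_split sum_nat_const card_ord muln1 /= addnK.
Qed.

Lemma code_split : code_hypergraph (split_hypergraph D)
  = [:: N, size hs + (N - #|V|) & split_body #|V| hs].
Proof. by rewrite /code_hypergraph card_ord size_split code_split_body. Qed.

Lemma tree_sizes : [seq size (nodes (tree D v)) | v <- enum V]
  = mkseq (fun k => block_size (incidences hs k)) #|V|.
Proof.
rewrite -map_code_enum; apply: eq_map => v.
by rewrite size_map size_iota.
Qed.

Lemma code_starts_caterpillar :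
  code_starts D = mkseq (block_start (incidences hs)) #|V|.+1.
Proof.
rewrite /code_starts tree_sizes; apply: (@eq_from_nth _ 0) => [|i].
  by rewrite size_mkseq /= size_scanl size_mkseq.
rewrite /= size_scanl size_mkseq => iV; rewrite nth_mkseq //.
case: i iV => [|i] iV; first by rewrite /block_start big_ord0.
have foldl_sumn x s : foldl addn x s = x + sumn s.
  by elim: s x => [|y s IH] x /=; rewrite ?addn0 // IH addnA.
rewrite /= nth_scanl ?size_mkseq // foldl_sumn /mkseq -map_take take_iota (minn_idPl _) //.
by rewrite sumnE big_map -[iota 0 i.+1]/(index_iota 0 i.+1) big_mkord.
Qed.

Lemma code_blocks_caterpillar : code_blocks D = iota 0 N.
Proof.
rewrite /code_blocks.
have -> : [seq [seq code_elt w | w <- nodes (tree D v)] | v <- enum V]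
    = mkseq (fun k => iota (start k) (block_size (incidences hs k))) #|V|.
  rewrite -map_code_enum; apply: eq_map => v; rewrite -map_comp.
  have -> d : iota (start (code_elt v)) d = [seq start (code_elt v) + j | j <- iota 0 d].
    by rewrite -iotaDl addn0.
  apply/eq_in_map => j; rewrite mem_iota add0n => /andP [_ jb].
  by rewrite /= code_node.
elim: #|V| => [|k IHk]; first by rewrite /block_start big_ord0.
by rewrite flatten_mkseqS IHk block_startS iotaD.
Qed.

Lemma size_code_terminals : size (code_terminals D) = N.
Proof. by rewrite size_map -cardE card_ord. Qed.

Lemma code_terminals_caterpillar k x : k < #|V| -> x < block_size (incidences hs k) ->
  nth 0 (code_terminals D) (start k + x)
  = if x == (block_size (incidences hs k)).-1 then k.+1 else 0.
Proof.
move=> kV; have [v <-] := code_onto kV => {k kV} xb.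
have wN : start (code_elt v) + x < N by apply: block_bound => //; apply: code_lt.
rewrite /code_terminals (nth_map (caterpillar_term H v)) -?cardE ?card_ord //.
have -> : nth (caterpillar_term H v) (enum 'I_N) (start (code_elt v) + x) = caterpillar_node H v x.
  by apply: val_inj; rewrite /= nth_enum_ord // val_caterpillar_node.
case: pickP => [u /eqP|noterm].
  rewrite /= caterpillar_termE => /caterpillar_node_inj [] // uv xE; subst u.
  by rewrite -xE eqxx.
case: (x =P _) => // xE; have := noterm v.
by rewrite /= caterpillar_termE -xE eqxx.
Qed.

End CaterpillarCodes.

Lemma incidence_length_codes (V : finType) (H : hypergraph V) :
  incidence_length H = #|V| + size (number_lists H) + \sum_(A <- number_lists H) size A.
Proof. by rewrite total_number_lists size_map. Qed.

(** The words and the time are bounded through the number of nodes, which is at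
    most the number of vertices plus twice the number of listed incidences. *)
Lemma build_correct (V : finType) (H : hypergraph V) :
  computes_within (100 * (incidence_length H).+1) (100 * (incidence_length H).+1) split_prog
    [:: code_hypergraph H]
    (code_hypergraph (split_hypergraph (caterpillar_splitting H))
      :: code_tables (caterpillar_splitting H)).
Proof.
set hs := number_lists H.
have w_large : 10 * (#|V| + size hs + \sum_(A <- hs) size A).+1 <= 100 * (incidence_length H).+1.
  by rewrite incidence_length_codes leq_mul2r orbT.
have [t [s [ex tb [s1 s2 s3 [s4 _]]]]] : runs (100 * (incidence_length H).+1) split_prog
    (load [:: code_hypergraph H]) (100 * (incidence_length H).+1) (built_spec #|V| hs).
  rewrite {2}incidence_length_codes; apply: split_prog_runs => //.
  - exact: number_lists_lt.
  - by move=> j; rewrite /load /= code_input.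
  - by move=> [|a] j //= _; rewrite /load /= nth_nil nth_nil.
exists t, s; split=> // k i.
rewrite /code_tables code_split code_starts_caterpillar code_blocks_caterpillar.
case: k => [|[|[|[|k]]]] //= _.
- by rewrite size_iota => iN; rewrite s3 // nth_iota.
- rewrite size_code_terminals => /block_find [k [x [kV xb ->]]].
  by rewrite s4 // code_terminals_caterpillar.
Qed.

(** * The isomorphism, its size bounds and its linear-time computation *)

Theorem theorem5p4 :
  (forall (c : nat) (V : finType) (H : hypergraph V) (W : finType)
          (D : splitting H W), valid_splitting c D ->
     [/\ subset_iso (hat D) (Stop H) (Stop (split_hypergraph D)),
         {in Stop H, cancel (hat D) (unhat D)} /\
         {in Stop (split_hypergraph D), cancel (unhat D) (hat D)},
         hat D set0 = set0,
         bij_between (hat D) (minimal_nonempty (Stop H))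
           (minimal_nonempty (Stop (split_hypergraph D))) &
         [/\ coatoms (models (horn_cnf H))
               = [set ~: S | S in minimal_nonempty (Stop H)],
             coatoms (models (horn_cnf (split_hypergraph D)))
               = [set ~: T | T in minimal_nonempty (Stop (split_hypergraph D))] &
             bij_between (fun M : {set V} => ~: hat D (~: M))
               (coatoms (models (horn_cnf H)))
               (coatoms (models (horn_cnf (split_hypergraph D))))]]
     /\
     [/\ max_degree (split_hypergraph D) <= 3,
         rank (split_hypergraph D) <= maxn 2 (rank H),
         normalized H -> normalized (split_hypergraph D) &
         all (fun A : seq V => (#|A| == 2) || (#|A| == 3)) H ->
         all (fun A : seq W => (#|A| == 2) || (#|A| == 3)) (split_hypergraph D)])
  /\
  (forall c : nat, exists C : nat,
     forall (V : finType) (H : hypergraph V) (W : finType)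
            (D : splitting H W), valid_splitting c D ->
       incidence_length (split_hypergraph D) <= C * incidence_length H)
  /\
  (exists (c C : nat) (build : prog),
     forall (V : finType) (H : hypergraph V),
     exists (N : nat) (D : splitting H 'I_N),
       valid_splitting c D /\
       computes_within (C * (incidence_length H).+1)
         (C * (incidence_length H).+1) build
         [:: code_hypergraph H] (code_hypergraph (split_hypergraph D) :: code_tables D))
  /\
  (exists (C : nat) (fwd bwd : prog),
     forall (c : nat) (V : finType) (H : hypergraph V) (W : finType)
            (D : splitting H W), valid_splitting c D ->
       (forall S : seq V, uniq S -> exists S' : seq W,
          [/\ uniq S', [set w in S'] = hat D [set v in S] &
              computes_within (C * (incidence_length (split_hypergraph D)).+1)
                (C * (size S + size S').+1) fwd
                (rcons (code_tables D) (code_list S)) [:: code_list S']]) /\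
       (forall T : seq W, uniq T -> exists T' : seq V,
          [/\ uniq T', [set v in T'] = unhat D [set w in T] &
              computes_within (C * (incidence_length (split_hypergraph D)).+1)
                (C * (size T + size T').+1) bwd
                (rcons (code_tables D) (code_list T)) [:: code_list T']])).
Proof.
split; last split; last split.
- move=> c V H W D valD; split.
    split; [exact: hat_iso valD| |exact: hat0|exact: hat_minimal_bij valD|].
      by split; [move=> S _; exact: (hatK valD)|exact: unhatK valD].
    by split; [exact: coatoms_stopping|exact: coatoms_stopping|exact: hat_coatoms_bij valD].
  split; [exact: max_degree_split valD|exact: rank_split valD|
    exact: split_normalized valD|exact: split_size23 valD].
- by move=> c; exists (4 * c + 9) => V H W D; apply: incidence_length_split.
(* A caterpillar with d > 0 occurrences has 2d nodes. *)
- exists 2, 100, split_prog => V H; exists _, (caterpillar_splitting H).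
  by split; [exact: caterpillar_valid|exact: build_correct].
(* Five steps look up a terminal; a copied node or a block takes four. *)
- exists 5, hat_prog, unhat_prog => c V H W D valD.
  by split=> S; [exact: hat_computed valD S|exact: unhat_computed valD S].
Qed.
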